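(* Let $\mathfrak{g}$ be a complex Lie algebra and $\mathfrak{n}$ a Lie subalgebra of $\mathfrak{g}$ such that the adjoint $\mathfrak{n}$-module $\mathfrak{g}/\mathfrak{n}$ belongs to $\mathfrak{W}^{\mathfrak{n}}_{\mathfrak{n}}$. Let $M\in\mathfrak{W}^{\mathfrak{g}}_{\mathfrak{n}}$. (i) For any $I\in \mathrm{Irr}_{\mathfrak{n}}^{f}/\sim$ the vector space $M_I$ is a $\mathfrak{g}$-submodule of $M$. Moreover, for any simple finite dimensional $\mathfrak{n}$-module $L$, $[M_I:L]\neq 0$ implies $L\in I$. (ii) $M=\bigoplus_{I\in \mathrm{Irr}_{\mathfrak{n}}^{f}/\sim} M_I$. (iii) If $I,J\in \mathrm{Irr}_{\mathfrak{n}}^{f}/\sim$ and $I\neq J$, then $\mathrm{Hom}_{\mathfrak{g}}(M_I,M_J)=0$.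
   Context: Everything is over $\mathbb{C}$; Lie algebras may be infinite dimensional, and all vector spaces are assumed to have at most countable dimension. $\mathfrak{W}^{\mathfrak{g}}_{\mathfrak{n}}$ is the full subcategory of the category of all $\mathfrak{g}$-modules consisting of those $M$ on which $\mathfrak{n}$ acts locally finitely ($\dim U(\mathfrak{n})v<\infty$ for all $v\in M$); $\mathfrak{W}^{\mathfrak{n}}_{\mathfrak{n}}$ is the case $\mathfrak{g}=\mathfrak{n}$. Multiplicities: for a finite dimensional $\mathfrak{n}$-module $X$ and a simple finite dimensional $\mathfrak{n}$-module $L$, $[X:L]$ is the Jordan–Hölder multiplicity of $L$ in $X$. A locally finite module $M$ has a filtration $0=M_0\subset M_1\subset M_2\subset\dots$, $M=\bigcup_i M_i$, by finite dimensional $\mathfrak{n}$-invariant subspaces, and $[M:L]:=\sup_{i}[M_i:L]\in\{0,1,2,\dots,\infty\}$ (independent of the filtration). $\mathrm{Irr}_{\mathfrak{n}}^{f}$ is the set of isomorphism classes of simple finite dimensional $\mathfrak{n}$-modules; one writes $L\in X$ for $X\subset\mathrm{Irr}_{\mathfrak{n}}^{f}$ if the isomorphism class of $L$ is in $X$. The relation $\sim$ is the smallest equivalence relation on $\mathrm{Irr}_{\mathfrak{n}}^{f}$ such that: (I) $L\sim S$ if there is an indecomposable finite dimensional $\mathfrak{n}$-module $M$ with $[M:L]\neq 0$ and $[M:S]\neq 0$; (II) $L\sim S$ if $[(\mathfrak{g}/\mathfrak{n})\otimes L:S]\neq 0$. For $I\in \mathrm{Irr}_{\mathfrak{n}}^{f}/\sim$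 and $M\in\mathfrak{W}^{\mathfrak{g}}_{\mathfrak{n}}$, $M_I$ is the trace (the sum of all images of $\mathfrak{g}$-homomorphisms) in $M$ of all modules $\mathrm{Ind}^{\mathfrak{g}}_{\mathfrak{n}}N=U(\mathfrak{g})\otimes_{U(\mathfrak{n})}N$, where $N$ runs over the finite dimensional $\mathfrak{n}$-modules such that for every simple finite dimensional $\mathfrak{n}$-module $L$, $[N:L]\neq 0$ implies $L\in I$. *)

(* Defs.v *)
From HB Require Import structures.
From mathcomp Require Import all_boot all_order all_algebra.
From mathcomp Require Import complex.
From mathcomp Require Import boolp classical_sets functions reals ereal.

Set Implicit Arguments.
Unset Strict Implicit.
Unset Printing Implicit Defensive.

Import Order.TTheory GRing.Theory Num.Theory.
Local Open Scope quotient_scope.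
Local Open Scope classical_set_scope.
Local Open Scope ring_scope.

(** The ground field is [R[i]], for [R] a model of the real numbers. *)

Definition lspan (R : realType) (V : lmodType R[i]) (A : set V) : set V :=
  [set v | exists (k : nat) (c : 'I_k -> R[i]) (e : 'I_k -> V),
     (forall i, A (e i)) /\ v = \sum_(i < k) c i *: e i].

Definition findim (R : realType) (V : lmodType R[i]) (W : set V) : Prop :=
  exists (k : nat) (e : 'I_k -> V), W = lspan (range e).

(* The enumeration may repeat vectors, so finite dimension is allowed. *)
Definition countable_dim (R : realType) (V : lmodType R[i]) : Prop :=
  exists e : nat -> V, lspan (range e) = setT.

Definition is_subspace (R : realType) (V : lmodType R[i]) (W : set V) : Prop :=
  W 0 /\ forall (a : R[i]) (x y : V), W x -> W y -> W (a *: x + y).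

(** Internal direct sum of a family of subspaces; the index type carries no
    decidable equality, so finite subfamilies are injections from ['I_k]. *)
Definition direct_sum (R : realType) (V : lmodType R[i]) (T : Type)
    (W : T -> set V) : Prop :=
  (forall v : V, exists (k : nat) (J : 'I_k -> T) (x : 'I_k -> V),
     (forall i, W (J i) (x i)) /\ v = \sum_(i < k) x i) /\
  (forall (k : nat) (J : 'I_k -> T) (x : 'I_k -> V),
     injective J -> (forall i, W (J i) (x i)) ->
     \sum_(i < k) x i = 0 -> forall i, x i = 0).

Section Subspace.
Context {R : realType} {V : lmodType R[i]} {W : set V}.

Definition subspace (h : is_subspace W) : Type := set_type W.

Context (h : is_subspace W).
HB.instance Definition _ := Choice.copy (subspace h) (set_type W).

Definition ss_mk (x : V) (Wx : W x) : subspace h := exist _ x (mem_set Wx).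
Definition ss_val (x : subspace h) : V := set_val x.

Lemma ss_inj : injective ss_val.
Proof. exact: val_inj. Qed.

Lemma ss_valP (x : subspace h) : W (ss_val x).
Proof. exact: set_valP. Qed.

Lemma is_subspaceD x y : W x -> W y -> W (x + y).
Proof. by move=> Wx Wy; rewrite -[x]scale1r; apply: h.2. Qed.

Lemma is_subspaceZ a x : W x -> W (a *: x).
Proof. by move=> Wx; rewrite -[_ *: _]addr0; apply: h.2 => //; exact: h.1. Qed.

Lemma is_subspaceN x : W x -> W (- x).
Proof. by rewrite -scaleN1r; exact: is_subspaceZ. Qed.

Definition ss_zero := ss_mk h.1.
Definition ss_opp x := ss_mk (is_subspaceN (ss_valP x)).
Definition ss_add x y := ss_mk (is_subspaceD (ss_valP x) (ss_valP y)).
Definition ss_scale a x := ss_mk (is_subspaceZ a (ss_valP x)).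

Fact ss_addA : associative ss_add.
Proof. by move=> x y z; apply: ss_inj; exact: addrA. Qed.
Fact ss_addC : commutative ss_add.
Proof. by move=> x y; apply: ss_inj; exact: addrC. Qed.
Fact ss_add0 : left_id ss_zero ss_add.
Proof. by move=> x; apply: ss_inj; exact: add0r. Qed.
Fact ss_addN : left_inverse ss_zero ss_opp ss_add.
Proof. by move=> x; apply: ss_inj; exact: addNr. Qed.

HB.instance Definition _ :=
  GRing.isZmodule.Build (subspace h) ss_addA ss_addC ss_add0 ss_addN.

Fact ss_scaleA a b x : ss_scale a (ss_scale b x) = ss_scale (a * b) x.
Proof. by apply: ss_inj; exact: scalerA. Qed.
Fact ss_scale1 : left_id 1 ss_scale.
Proof. by move=> x; apply: ss_inj; exact: scale1r. Qed.
Fact ss_scaleDr : right_distributive ss_scale +%R.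
Proof. by move=> a x y; apply: ss_inj; exact: scalerDr. Qed.
Fact ss_scaleDl x : {morph ss_scale^~ x : a b / a + b}.
Proof. by move=> a b; apply: ss_inj; exact: scalerDl. Qed.

HB.instance Definition _ := GRing.Zmodule_isLmodule.Build R[i] (subspace h)
  ss_scaleA ss_scale1 ss_scaleDr ss_scaleDl.

End Subspace.

Section QuotientSpace.
Context {R : realType} {V : lmodType R[i]} {W : set V} (h : is_subspace W).

Definition qs_rel : rel V := fun x y => `[< W (x - y) >].

Fact qs_refl : reflexive qs_rel.
Proof. by move=> x; apply/asboolP; rewrite subrr; exact: h.1. Qed.
Fact qs_sym : symmetric qs_rel.
Proof.
have s x y : qs_rel x y -> qs_rel y x.
  by move=> /asboolP Wxy; apply/asboolP; rewrite -opprB; exact: is_subspaceN.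
by move=> x y; apply/idP/idP; exact: s.
Qed.
Fact qs_trans : transitive qs_rel.
Proof.
move=> y x z /asboolP Wxy /asboolP Wyz; apply/asboolP.
by rewrite -(subrKA y); exact: is_subspaceD.
Qed.

Definition qs_equiv := EquivRel qs_rel qs_refl qs_sym qs_trans.
Definition quotient_space : Type := {eq_quot qs_equiv}.

HB.instance Definition _ := Choice.on quotient_space.
HB.instance Definition _ := EqQuotient.on quotient_space.

Lemma qs_eqP (x y : V) : x = y %[mod quotient_space] <-> W (x - y).
Proof.
by split=> [/eqmodP /asboolP //|Wxy]; apply/eqmodP/asboolP.
Qed.

Lemma qs_reprP (x : V) : W (repr (\pi_quotient_space x) - x).
Proof. by apply/qs_eqP; rewrite reprK. Qed.

Notation pi := (\pi_quotient_space).
Definition qs_zero : quotient_space := pi 0.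
Definition qs_opp (x : quotient_space) : quotient_space := pi (- repr x).
Definition qs_add (x y : quotient_space) : quotient_space :=
  pi (repr x + repr y).
Definition qs_scale a (x : quotient_space) : quotient_space :=
  pi (a *: repr x).

Lemma qs_piN x : qs_opp (pi x) = pi (- x).
Proof. by apply/qs_eqP; rewrite -opprD; apply: is_subspaceN => //; exact: qs_reprP. Qed.
Lemma qs_piD x y : qs_add (pi x) (pi y) = pi (x + y).
Proof.
by apply/qs_eqP; rewrite opprD addrACA; apply: is_subspaceD => //; exact: qs_reprP.
Qed.
Lemma qs_piZ a x : qs_scale a (pi x) = pi (a *: x).
Proof. by apply/qs_eqP; rewrite -scalerBr; apply: is_subspaceZ => //; exact: qs_reprP. Qed.

Lemma qs_surj (x : quotient_space) : exists y, x = pi y.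
Proof. by exists (repr x); rewrite reprK. Qed.

Fact qs_addA : associative qs_add.
Proof.
move=> x y z; have [[a ->] [b ->] [c ->]] := And3 (qs_surj x) (qs_surj y) (qs_surj z).
by rewrite !qs_piD addrA.
Qed.
Fact qs_addC : commutative qs_add.
Proof. by move=> x y; rewrite /qs_add addrC. Qed.
Fact qs_add0 : left_id qs_zero qs_add.
Proof. by move=> x; have [a ->] := qs_surj x; rewrite qs_piD add0r. Qed.
Fact qs_addN : left_inverse qs_zero qs_opp qs_add.
Proof. by move=> x; have [a ->] := qs_surj x; rewrite qs_piN qs_piD addNr. Qed.

HB.instance Definition _ :=
  GRing.isZmodule.Build quotient_space qs_addA qs_addC qs_add0 qs_addN.

Fact qs_scaleA a b x : qs_scale a (qs_scale b x) = qs_scale (a * b) x.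
Proof. by have [y ->] := qs_surj x; rewrite !qs_piZ scalerA. Qed.
Fact qs_scale1 : left_id 1 qs_scale.
Proof. by move=> x; have [y ->] := qs_surj x; rewrite !qs_piZ scale1r. Qed.
Fact qs_scaleDr : right_distributive qs_scale +%R.
Proof.
move=> a x y; have [[u ->] [v ->]] := conj (qs_surj x) (qs_surj y).
by rewrite -[pi u + pi v]/(qs_add _ _) qs_piD !qs_piZ scalerDr -qs_piD.
Qed.
Fact qs_scaleDl x : {morph qs_scale^~ x : a b / a + b}.
Proof.
by move=> a b; have [u ->] := qs_surj x; rewrite !qs_piZ scalerDl -qs_piD.
Qed.

HB.instance Definition _ := GRing.Zmodule_isLmodule.Build R[i] quotient_space
  qs_scaleA qs_scale1 qs_scaleDr qs_scaleDl.

Lemma pi_is_linear a x y : pi (a *: x + y) = a *: pi x + pi y :> quotient_space.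
Proof. by rewrite -qs_piD -qs_piZ. Qed.

End QuotientSpace.

(** [tensor ra la] is the complex vector space X (x)_A Y, for a right action
    [ra] of A on X and a left action [la] of A on Y: the vector space presented
    by the generators x (x) y subject to C-bilinearity and to
    (x . a) (x) y = x (x) (a . y). *)

Section Tensor.
Context {R : realType} {A : Type} {X Y : lmodType R[i]}.
Context (ra : X -> A -> X) (la : A -> Y -> Y).

Inductive tterm : Type :=
  | TPure of X & Y
  | TZero
  | TAdd of tterm & tterm
  | TScale of R[i] & tterm.

Inductive tcong : tterm -> tterm -> Prop :=
  | tcong_refl s : tcong s s
  | tcong_sym s t : tcong s t -> tcong t s
  | tcong_trans s t u : tcong s t -> tcong t u -> tcong s u
  | tcong_add s s' t t' :
      tcong s s' -> tcong t t' -> tcong (TAdd s t) (TAdd s' t')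
  | tcong_scale a s s' : tcong s s' -> tcong (TScale a s) (TScale a s')
  | tcong_addA s t u : tcong (TAdd s (TAdd t u)) (TAdd (TAdd s t) u)
  | tcong_addC s t : tcong (TAdd s t) (TAdd t s)
  | tcong_add0 s : tcong (TAdd TZero s) s
  | tcong_addN s : tcong (TAdd (TScale (-1) s) s) TZero
  | tcong_scaleA a b s : tcong (TScale a (TScale b s)) (TScale (a * b) s)
  | tcong_scale1 s : tcong (TScale 1 s) s
  | tcong_scaleDr a s t :
      tcong (TScale a (TAdd s t)) (TAdd (TScale a s) (TScale a t))
  | tcong_scaleDl a b s :
      tcong (TScale (a + b) s) (TAdd (TScale a s) (TScale b s))
  | tcong_linl a x x' y :
      tcong (TPure (a *: x + x') y) (TAdd (TScale a (TPure x y)) (TPure x' y))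
  | tcong_linr a x y y' :
      tcong (TPure x (a *: y + y')) (TAdd (TScale a (TPure x y)) (TPure x y'))
  | tcong_balance x a y : tcong (TPure (ra x a) y) (TPure x (la a y)).

HB.instance Definition _ := gen_eqMixin tterm.
HB.instance Definition _ := gen_choiceMixin tterm.

Definition trel : rel tterm := fun s t => `[< tcong s t >].
Fact trel_refl : reflexive trel.
Proof. by move=> s; apply/asboolP; exact: tcong_refl. Qed.
Fact trel_sym : symmetric trel.
Proof.
by move=> s t; apply/idP/idP => /asboolP st; apply/asboolP; exact: tcong_sym.
Qed.
Fact trel_trans : transitive trel.
Proof.
by move=> t s u /asboolP st /asboolP tu; apply/asboolP; exact: tcong_trans tu.
Qed.

Definition tequiv := EquivRel trel trel_refl trel_sym trel_trans.
Definition tensor : Type := {eq_quot tequiv}.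
HB.instance Definition _ := Choice.on tensor.
HB.instance Definition _ := EqQuotient.on tensor.

Notation tpi := (\pi_tensor).

Lemma tensor_eqP s t : s = t %[mod tensor] <-> tcong s t.
Proof. by split=> [/eqmodP /asboolP //|st]; apply/eqmodP/asboolP. Qed.

Lemma tensor_reprP s : tcong (repr (tpi s)) s.
Proof. by apply/tensor_eqP; rewrite reprK. Qed.

Lemma tensor_surj (z : tensor) : exists s, z = tpi s.
Proof. by exists (repr z); rewrite reprK. Qed.

Definition pure (x : X) (y : Y) : tensor := tpi (TPure x y).
Definition tensor_zero : tensor := tpi TZero.
Definition tensor_scale a (z : tensor) : tensor := tpi (TScale a (repr z)).
Definition tensor_opp (z : tensor) : tensor := tensor_scale (-1) z.
Definition tensor_add (z w : tensor) : tensor := tpi (TAdd (repr z) (repr w)).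

Lemma tensor_piD s t : tensor_add (tpi s) (tpi t) = tpi (TAdd s t).
Proof. by apply/tensor_eqP/tcong_add; exact: tensor_reprP. Qed.
Lemma tensor_piZ a s : tensor_scale a (tpi s) = tpi (TScale a s).
Proof. by apply/tensor_eqP/tcong_scale; exact: tensor_reprP. Qed.

Fact tensor_addA : associative tensor_add.
Proof.
move=> x y z.
have [[a ->] [b ->] [c ->]] := And3 (tensor_surj x) (tensor_surj y) (tensor_surj z).
by rewrite !tensor_piD; apply/tensor_eqP/tcong_addA.
Qed.
Fact tensor_addC : commutative tensor_add.
Proof. by move=> x y; apply/tensor_eqP/tcong_addC. Qed.
Fact tensor_add0 : left_id tensor_zero tensor_add.
Proof.
move=> x; have [a ->] := tensor_surj x.
by rewrite tensor_piD; apply/tensor_eqP/tcong_add0.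
Qed.
Fact tensor_addN : left_inverse tensor_zero tensor_opp tensor_add.
Proof.
move=> x; have [a ->] := tensor_surj x.
by rewrite /tensor_opp tensor_piZ tensor_piD; apply/tensor_eqP/tcong_addN.
Qed.

HB.instance Definition _ :=
  GRing.isZmodule.Build tensor tensor_addA tensor_addC tensor_add0 tensor_addN.

Fact tensor_scaleA a b x :
  tensor_scale a (tensor_scale b x) = tensor_scale (a * b) x.
Proof.
have [s ->] := tensor_surj x.
by rewrite !tensor_piZ; apply/tensor_eqP/tcong_scaleA.
Qed.
Fact tensor_scale1 : left_id 1 tensor_scale.
Proof.
move=> x; have [s ->] := tensor_surj x.
by rewrite tensor_piZ; apply/tensor_eqP/tcong_scale1.
Qed.
Fact tensor_scaleDr : right_distributive tensor_scale +%R.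
Proof.
move=> a x y; have [[s ->] [t ->]] := conj (tensor_surj x) (tensor_surj y).
rewrite -[tpi s + tpi t]/(tensor_add _ _) tensor_piD !tensor_piZ.
rewrite -[_ + _]/(tensor_add _ _) tensor_piD.
exact/tensor_eqP/tcong_scaleDr.
Qed.
Fact tensor_scaleDl x : {morph tensor_scale^~ x : a b / a + b}.
Proof.
move=> a b; have [s ->] := tensor_surj x.
rewrite !tensor_piZ -[tpi _ + tpi _]/(tensor_add _ _) tensor_piD.
exact/tensor_eqP/tcong_scaleDl.
Qed.

HB.instance Definition _ := GRing.Zmodule_isLmodule.Build R[i] tensor
  tensor_scaleA tensor_scale1 tensor_scaleDr tensor_scaleDl.

Lemma tpiD s t : tpi (TAdd s t) = tpi s + tpi t.
Proof. by rewrite -tensor_piD. Qed.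
Lemma tpiZ a s : tpi (TScale a s) = a *: (tpi s : tensor).
Proof. by rewrite -tensor_piZ. Qed.

Lemma pure_linl a x x' y : pure (a *: x + x') y = a *: pure x y + pure x' y.
Proof. by rewrite /pure -tpiZ -tpiD; apply/tensor_eqP/tcong_linl. Qed.
Lemma pure_linr a x y y' : pure x (a *: y + y') = a *: pure x y + pure x y'.
Proof. by rewrite /pure -tpiZ -tpiD; apply/tensor_eqP/tcong_linr. Qed.
Lemma pure_balance x a y : pure (ra x a) y = pure x (la a y).
Proof. exact/tensor_eqP/tcong_balance. Qed.

Lemma tensor_ind (P : tensor -> Prop) :
  (forall x y, P (pure x y)) -> P 0 -> (forall z w, P z -> P w -> P (z + w)) ->
  (forall a z, P z -> P (a *: z)) -> forall z, P z.
Proof.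
move=> Pp P0 PD PZ z; have [s ->] := tensor_surj z.
elim: s => [x y||s IHs t IHt|a s IHs]; [exact: Pp|exact: P0| |].
- by rewrite tpiD; exact: PD.
- by rewrite tpiZ; exact: PZ.
Qed.

Section Lift.
Context {Z : lmodType R[i]}.

Record balanced (phi : X -> Y -> Z) : Prop := Balanced {
  balanced_linl : forall a x x' y, phi (a *: x + x') y = a *: phi x y + phi x' y;
  balanced_linr : forall a x y y', phi x (a *: y + y') = a *: phi x y + phi x y';
  balanced_mid : forall x a y, phi (ra x a) y = phi x (la a y) }.

Context (phi : X -> Y -> Z).

Fixpoint teval (s : tterm) : Z :=
  match s with
  | TPure x y => phi x y
  | TZero => 0
  | TAdd s t => teval s + teval t
  | TScale a s => a *: teval s
  end.

Definition tensor_lift (z : tensor) : Z := teval (repr z).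

Context (hphi : balanced phi).

Lemma teval_cong s t : tcong s t -> teval s = teval t.
Proof.
elim=> //=.
- by move=> s' t' u _ -> _ ->.
- by move=> s1 s2 t1 t2 _ -> _ ->.
- by move=> a s1 s2 _ ->.
- by move=> *; rewrite addrA.
- by move=> *; rewrite addrC.
- by move=> *; rewrite add0r.
- by move=> *; rewrite scaleN1r addNr.
- by move=> *; rewrite scalerA.
- by move=> *; rewrite scale1r.
- by move=> *; rewrite scalerDr.
- by move=> *; rewrite scalerDl.
- by move=> *; rewrite hphi.(balanced_linl).
- by move=> *; rewrite hphi.(balanced_linr).
- by move=> *; rewrite hphi.(balanced_mid).
Qed.

Lemma tensor_lift_pi s : tensor_lift (tpi s) = teval s.
Proof. exact/teval_cong/tensor_reprP. Qed.

Lemma tensor_lift_pure x y : tensor_lift (pure x y) = phi x y.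
Proof. exact: tensor_lift_pi. Qed.

Lemma tensor_lift_linear a z w :
  tensor_lift (a *: z + w) = a *: tensor_lift z + tensor_lift w.
Proof.
have [[s ->] [t ->]] := conj (tensor_surj z) (tensor_surj w).
by rewrite -tpiZ -tpiD !tensor_lift_pi.
Qed.

End Lift.
End Tensor.

Record lieAlgebra (R : realType) := LieAlgebra {
  lie_sort :> lmodType R[i];
  lie : lie_sort -> lie_sort -> lie_sort;
  lie_linl : forall a x y z, lie (a *: x + y) z = a *: lie x z + lie y z;
  lie_linr : forall a x y z, lie x (a *: y + z) = a *: lie x y + lie x z;
  liexx : forall x, lie x x = 0;
  lie_jacobi : forall x y z,
    lie x (lie y z) + lie y (lie z x) + lie z (lie x y) = 0 }.

Lemma lie_anti (R : realType) (g : lieAlgebra R) (x y : g) :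
  lie x y = - lie y x.
Proof.
have linl u v w : lie (u + v) w = lie u w + lie v w :> g.
  by rewrite -{1}[u]scale1r lie_linl scale1r.
have linr u v w : lie u (v + w) = lie u v + lie u w :> g.
  by rewrite -{1}[v]scale1r lie_linr scale1r.
have := liexx (x + y); rewrite linl !linr !liexx add0r addr0 => /eqP.
by rewrite addr_eq0 => /eqP.
Qed.

Record lieSubalgebra (R : realType) (g : lieAlgebra R) := LieSubalgebra {
  lsub_set : set g;
  lsub_subspace : is_subspace lsub_set;
  lsub_lie : forall x y, lsub_set x -> lsub_set y -> lsub_set (lie x y) }.

Section LieOfSub.
Context {R : realType} {g : lieAlgebra R} (n : lieSubalgebra g).
Let S := subspace (lsub_subspace n).

Definition lsub_bracket (x y : S) : S :=
  ss_mk (lsub_subspace n)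
    (lsub_lie (ss_valP (h := lsub_subspace n) x) (ss_valP (h := lsub_subspace n) y)).

Fact lsub_linl a x y z :
  lsub_bracket (a *: x + y) z = a *: lsub_bracket x z + lsub_bracket y z.
Proof. by apply: ss_inj; exact: lie_linl. Qed.
Fact lsub_linr a x y z :
  lsub_bracket x (a *: y + z) = a *: lsub_bracket x y + lsub_bracket x z.
Proof. by apply: ss_inj; exact: lie_linr. Qed.
Fact lsub_xx x : lsub_bracket x x = 0.
Proof. by apply: ss_inj; exact: liexx. Qed.
Fact lsub_jacobi x y z :
  lsub_bracket x (lsub_bracket y z) + lsub_bracket y (lsub_bracket z x)
    + lsub_bracket z (lsub_bracket x y) = 0.
Proof. by apply: ss_inj; exact: lie_jacobi. Qed.

Definition lie_of_sub : lieAlgebra R :=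
  LieAlgebra lsub_linl lsub_linr lsub_xx lsub_jacobi.

Definition lsub_val (x : lie_of_sub) : g := ss_val x.

End LieOfSub.
Coercion lie_of_sub : lieSubalgebra >-> lieAlgebra.

Record lieModule (R : realType) (g : lieAlgebra R) := LieModule {
  lmod_sort :> lmodType R[i];
  act : g -> lmod_sort -> lmod_sort;
  act_linl : forall a x y v, act (a *: x + y) v = a *: act x v + act y v;
  act_linr : forall a x v w, act x (a *: v + w) = a *: act x v + act x w;
  act_lie : forall x y v, act (lie x y) v = act x (act y v) - act y (act x v) }.

Record lieHom (R : realType) (g : lieAlgebra R) (M N : lieModule g) := LieHom {
  lhom_fun :> {linear M -> N};
  lhom_act : forall x v, lhom_fun (act x v) = act x (lhom_fun v) }.

Definition isomorphic (R : realType) (g : lieAlgebra R) (M N : lieModule g) : Prop :=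
  exists f : lieHom M N, bijective f.

Definition is_submodule (R : realType) (g : lieAlgebra R) (M : lieModule g)
    (W : set M) : Prop :=
  is_subspace W /\ forall x v, W v -> W (act x v).

Section Adjoint.
Context {R : realType} (g : lieAlgebra R).

Fact adjoint_lie (x y v : g) :
  lie (lie x y) v = lie x (lie y v) - lie y (lie x v).
Proof.
have /eqP := lie_jacobi x y v.
have lieN (u w : g) : lie u (- w) = - lie u w.
  have h0 : lie u 0 = 0.
    by apply: (addIr (lie u 0)); rewrite -{1}[lie u 0]scale1r -lie_linr scaler0 !add0r.
  by rewrite -[- w]addr0 -scaleN1r lie_linr h0 addr0 scaleN1r.
rewrite addr_eq0 => /eqP h.
by rewrite (lie_anti (lie x y)) -h (lie_anti v x) lieN.
Qed.

Definition adjoint : lieModule g :=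
  LieModule (@lie_linl _ g) (fun a x v w => @lie_linr _ g a x v w) adjoint_lie.
End Adjoint.

Section Restriction.
Context {R : realType} {g : lieAlgebra R} (n : lieSubalgebra g) (M : lieModule g).

Definition restriction : lieModule n :=
  @LieModule R n M (fun x => act (lsub_val x))
    (fun a x y => act_linl a (lsub_val x) (lsub_val y))
    (fun a x => act_linr a (lsub_val x))
    (fun x y => act_lie (lsub_val x) (lsub_val y)).
End Restriction.

Section SubQuotient.
Context {R : realType} {g : lieAlgebra R} {M : lieModule g} {W : set M}.
Context (h : is_submodule W).

Definition sub_act (x : g) (v : subspace h.1) : subspace h.1 :=
  ss_mk h.1 (h.2 x _ (ss_valP (h := h.1) v)).

Fact sub_act_linl a x y v : sub_act (a *: x + y) v = a *: sub_act x v + sub_act y v.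
Proof. by apply: ss_inj; exact: act_linl. Qed.
Fact sub_act_linr a x v w : sub_act x (a *: v + w) = a *: sub_act x v + sub_act x w.
Proof. by apply: ss_inj; exact: act_linr. Qed.
Fact sub_act_lie x y v :
  sub_act (lie x y) v = sub_act x (sub_act y v) - sub_act y (sub_act x v).
Proof. by apply: ss_inj; exact: act_lie. Qed.

Definition submodule : lieModule g :=
  LieModule sub_act_linl sub_act_linr sub_act_lie.

Notation Q := (quotient_space h.1).

Definition quo_act (x : g) (v : Q) : Q := \pi_Q (act x (repr v)).

Lemma quo_act_pi x v : quo_act x (\pi_Q v) = \pi_Q (act x v).
Proof.
have actB (u w : M) : act x (u - w) = act x u - act x w.
  by rewrite -[u - w]addrC -scaleN1r act_linr scaleN1r addrC.
by apply/qs_eqP; rewrite -actB; apply/h.2/qs_reprP.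
Qed.

Fact quo_act_linl a x y v : quo_act (a *: x + y) v = a *: quo_act x v + quo_act y v.
Proof. by rewrite /quo_act act_linl pi_is_linear. Qed.
Fact quo_act_linr a x v w : quo_act x (a *: v + w) = a *: quo_act x v + quo_act x w.
Proof.
have [[s ->] [t ->]] := conj (qs_surj v) (qs_surj w).
by rewrite -pi_is_linear !quo_act_pi act_linr pi_is_linear.
Qed.
Fact quo_act_lie x y v :
  quo_act (lie x y) v = quo_act x (quo_act y v) - quo_act y (quo_act x v).
Proof.
have [s ->] := qs_surj v; rewrite !quo_act_pi act_lie.
by rewrite -scaleN1r addrC pi_is_linear scaleN1r addrC.
Qed.

Definition quotient_module : lieModule g :=
  LieModule quo_act_linl quo_act_linr quo_act_lie.

End SubQuotient.

Section Subquotient.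
Context {R : realType} {g : lieAlgebra R} {M : lieModule g} {A B : set M}.
Context (hA : is_submodule A) (hB : is_submodule B).

Fact sub_preimage_submodule :
  is_submodule ((fun v : submodule hB => A (ss_val v)) : set (submodule hB)).
Proof.
split; [split; [exact: hA.1.1|move=> a x y; exact: hA.1.2]|].
by move=> x v; exact: hA.2.
Qed.

(** B / (A :&: B); only used when A is contained in B. *)
Definition subquotient : lieModule g := quotient_module sub_preimage_submodule.

End Subquotient.

(** [envelope g] is U(g): the unital associative C-algebra generated by symbols
    [gen x], x in g, subject to linearity of [gen] and to
    [gen x * gen y - gen y * gen x = gen (lie x y)]. *)

Section Envelope.
Context {R : realType} (g : lieAlgebra R).

Inductive uterm : Type :=
  | UGen of g
  | UZero
  | UOne
  | UAdd of uterm & uterm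
  | UMul of uterm & uterm
  | UScale of R[i] & uterm.

Inductive ucong : uterm -> uterm -> Prop :=
  | ucong_refl s : ucong s s
  | ucong_sym s t : ucong s t -> ucong t s
  | ucong_trans s t u : ucong s t -> ucong t u -> ucong s u
  | ucong_add s s' t t' :
      ucong s s' -> ucong t t' -> ucong (UAdd s t) (UAdd s' t')
  | ucong_mul s s' t t' :
      ucong s s' -> ucong t t' -> ucong (UMul s t) (UMul s' t')
  | ucong_scale a s s' : ucong s s' -> ucong (UScale a s) (UScale a s')
  | ucong_addA s t u : ucong (UAdd s (UAdd t u)) (UAdd (UAdd s t) u)
  | ucong_addC s t : ucong (UAdd s t) (UAdd t s)
  | ucong_add0 s : ucong (UAdd UZero s) s
  | ucong_addN s : ucong (UAdd (UScale (-1) s) s) UZero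
  | ucong_scaleA a b s : ucong (UScale a (UScale b s)) (UScale (a * b) s)
  | ucong_scale1 s : ucong (UScale 1 s) s
  | ucong_scaleDr a s t :
      ucong (UScale a (UAdd s t)) (UAdd (UScale a s) (UScale a t))
  | ucong_scaleDl a b s :
      ucong (UScale (a + b) s) (UAdd (UScale a s) (UScale b s))
  | ucong_mulA s t u : ucong (UMul s (UMul t u)) (UMul (UMul s t) u)
  | ucong_mul1l s : ucong (UMul UOne s) s
  | ucong_mul1r s : ucong (UMul s UOne) s
  | ucong_mulDl s t u : ucong (UMul (UAdd s t) u) (UAdd (UMul s u) (UMul t u))
  | ucong_mulDr s t u : ucong (UMul s (UAdd t u)) (UAdd (UMul s t) (UMul s u))
  | ucong_scaleAl a s t : ucong (UScale a (UMul s t)) (UMul (UScale a s) t)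
  | ucong_scaleAr a s t : ucong (UScale a (UMul s t)) (UMul s (UScale a t))
  | ucong_gen_lin a x y :
      ucong (UGen (a *: x + y)) (UAdd (UScale a (UGen x)) (UGen y))
  | ucong_gen_lie x y :
      ucong (UGen (lie x y))
            (UAdd (UMul (UGen x) (UGen y)) (UScale (-1) (UMul (UGen y) (UGen x)))).

HB.instance Definition _ := gen_eqMixin uterm.
HB.instance Definition _ := gen_choiceMixin uterm.

Definition urel : rel uterm := fun s t => `[< ucong s t >].
Fact urel_refl : reflexive urel.
Proof. by move=> s; apply/asboolP; exact: ucong_refl. Qed.
Fact urel_sym : symmetric urel.
Proof.
by move=> s t; apply/idP/idP => /asboolP st; apply/asboolP; exact: ucong_sym.
Qed.
Fact urel_trans : transitive urel.
Proof.
by move=> t s u /asboolP st /asboolP tu; apply/asboolP; exact: ucong_trans tu.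
Qed.

Definition uequiv := EquivRel urel urel_refl urel_sym urel_trans.
Definition envelope : Type := {eq_quot uequiv}.
HB.instance Definition _ := Choice.on envelope.
HB.instance Definition _ := EqQuotient.on envelope.

Notation upi := (\pi_envelope).

Lemma envelope_eqP s t : s = t %[mod envelope] <-> ucong s t.
Proof. by split=> [/eqmodP /asboolP //|st]; apply/eqmodP/asboolP. Qed.

Lemma envelope_reprP s : ucong (repr (upi s)) s.
Proof. by apply/envelope_eqP; rewrite reprK. Qed.

Lemma envelope_surj (z : envelope) : exists s, z = upi s.
Proof. by exists (repr z); rewrite reprK. Qed.

Definition gen (x : g) : envelope := upi (UGen x).
Definition env_zero : envelope := upi UZero.
Definition env_one : envelope := upi UOne.
Definition env_scale a (z : envelope) : envelope := upi (UScale a (repr z)).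
Definition env_opp (z : envelope) : envelope := env_scale (-1) z.
Definition env_add (z w : envelope) : envelope := upi (UAdd (repr z) (repr w)).
Definition env_mul (z w : envelope) : envelope := upi (UMul (repr z) (repr w)).

Lemma env_piD s t : env_add (upi s) (upi t) = upi (UAdd s t).
Proof. by apply/envelope_eqP/ucong_add; exact: envelope_reprP. Qed.
Lemma env_piM s t : env_mul (upi s) (upi t) = upi (UMul s t).
Proof. by apply/envelope_eqP/ucong_mul; exact: envelope_reprP. Qed.
Lemma env_piZ a s : env_scale a (upi s) = upi (UScale a s).
Proof. by apply/envelope_eqP/ucong_scale; exact: envelope_reprP. Qed.

Fact env_addA : associative env_add.
Proof.
move=> x y z.
have [[a ->] [b ->] [c ->]] := And3 (envelope_surj x) (envelope_surj y) (envelope_surj z).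
by rewrite !env_piD; apply/envelope_eqP/ucong_addA.
Qed.
Fact env_addC : commutative env_add.
Proof. by move=> x y; apply/envelope_eqP/ucong_addC. Qed.
Fact env_add0 : left_id env_zero env_add.
Proof.
move=> x; have [a ->] := envelope_surj x.
by rewrite env_piD; apply/envelope_eqP/ucong_add0.
Qed.
Fact env_addN : left_inverse env_zero env_opp env_add.
Proof.
move=> x; have [a ->] := envelope_surj x.
by rewrite /env_opp env_piZ env_piD; apply/envelope_eqP/ucong_addN.
Qed.

HB.instance Definition _ :=
  GRing.isZmodule.Build envelope env_addA env_addC env_add0 env_addN.

Lemma upiD s t : upi (UAdd s t) = upi s + upi t.
Proof. by rewrite -env_piD. Qed.

Fact env_scaleA a b x : env_scale a (env_scale b x) = env_scale (a * b) x.
Proof.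
have [s ->] := envelope_surj x.
by rewrite !env_piZ; apply/envelope_eqP/ucong_scaleA.
Qed.
Fact env_scale1 : left_id 1 env_scale.
Proof.
move=> x; have [s ->] := envelope_surj x.
by rewrite env_piZ; apply/envelope_eqP/ucong_scale1.
Qed.
Fact env_scaleDr : right_distributive env_scale +%R.
Proof.
move=> a x y; have [[s ->] [t ->]] := conj (envelope_surj x) (envelope_surj y).
rewrite -upiD !env_piZ -upiD.
exact/envelope_eqP/ucong_scaleDr.
Qed.
Fact env_scaleDl x : {morph env_scale^~ x : a b / a + b}.
Proof.
move=> a b; have [s ->] := envelope_surj x.
rewrite !env_piZ -upiD.
exact/envelope_eqP/ucong_scaleDl.
Qed.

HB.instance Definition _ := GRing.Zmodule_isLmodule.Build R[i] envelope
  env_scaleA env_scale1 env_scaleDr env_scaleDl.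

Lemma upiZ a s : upi (UScale a s) = a *: (upi s : envelope).
Proof. by rewrite -env_piZ. Qed.

Fact env_mulA : associative env_mul.
Proof.
move=> x y z.
have [[a ->] [b ->] [c ->]] := And3 (envelope_surj x) (envelope_surj y) (envelope_surj z).
by rewrite !env_piM; apply/envelope_eqP/ucong_mulA.
Qed.
Fact env_mul1l : left_id env_one env_mul.
Proof.
move=> x; have [a ->] := envelope_surj x.
by rewrite env_piM; apply/envelope_eqP/ucong_mul1l.
Qed.
Fact env_mul1r : right_id env_one env_mul.
Proof.
move=> x; have [a ->] := envelope_surj x.
by rewrite env_piM; apply/envelope_eqP/ucong_mul1r.
Qed.
Fact env_mulDl : left_distributive env_mul +%R.
Proof.
move=> x y z.
have [[a ->] [b ->] [c ->]] := And3 (envelope_surj x) (envelope_surj y) (envelope_surj z).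
by rewrite -upiD !env_piM -upiD; apply/envelope_eqP/ucong_mulDl.
Qed.
Fact env_mulDr : right_distributive env_mul +%R.
Proof.
move=> x y z.
have [[a ->] [b ->] [c ->]] := And3 (envelope_surj x) (envelope_surj y) (envelope_surj z).
by rewrite -upiD !env_piM -upiD; apply/envelope_eqP/ucong_mulDr.
Qed.

Fixpoint uaug (s : uterm) : R[i] :=
  match s with
  | UGen _ => 0
  | UZero => 0
  | UOne => 1
  | UAdd s t => uaug s + uaug t
  | UMul s t => uaug s * uaug t
  | UScale a s => a * uaug s
  end.

Lemma uaug_cong s t : ucong s t -> uaug s = uaug t.
Proof.
elim=> //=.
- by move=> s' t' u _ -> _ ->.
- by move=> s1 s2 t1 t2 _ -> _ ->.
- by move=> s1 s2 t1 t2 _ -> _ ->.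
- by move=> a s1 s2 _ ->.
- by move=> *; rewrite addrA.
- by move=> *; rewrite addrC.
- by move=> *; rewrite add0r.
- by move=> *; rewrite mulN1r addNr.
- by move=> *; rewrite mulrA.
- by move=> *; rewrite mul1r.
- by move=> *; rewrite mulrDr.
- by move=> *; rewrite mulrDl.
- by move=> *; rewrite mulrA.
- by move=> *; rewrite mul1r.
- by move=> *; rewrite mulr1.
- by move=> *; rewrite mulrDl.
- by move=> *; rewrite mulrDr.
- by move=> *; rewrite mulrA.
- by move=> *; rewrite mulrCA.
- by move=> *; rewrite mulr0 addr0.
- by move=> *; rewrite mul0r mulr0 addr0.
Qed.

Fact env_one_neq0 : env_one != 0.
Proof.
apply/eqP => /envelope_eqP /uaug_cong /= /eqP.
by rewrite oner_eq0.
Qed.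

HB.instance Definition _ := GRing.Zmodule_isNzRing.Build envelope
  env_mulA env_mul1l env_mul1r env_mulDl env_mulDr env_one_neq0.

Lemma upiM s t : upi (UMul s t) = upi s * upi t.
Proof. by rewrite -env_piM. Qed.

Fact env_scaleAl a (x y : envelope) : a *: (x * y) = (a *: x) * y.
Proof.
have [[s ->] [t ->]] := conj (envelope_surj x) (envelope_surj y).
by rewrite -upiM -!upiZ -upiM; apply/envelope_eqP/ucong_scaleAl.
Qed.
Fact env_scaleAr a (x y : envelope) : a *: (x * y) = x * (a *: y).
Proof.
have [[s ->] [t ->]] := conj (envelope_surj x) (envelope_surj y).
by rewrite -upiM -!upiZ -upiM; apply/envelope_eqP/ucong_scaleAr.
Qed.

HB.instance Definition _ :=
  GRing.Lmodule_isLalgebra.Build R[i] envelope env_scaleAl.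
HB.instance Definition _ :=
  GRing.Lalgebra_isAlgebra.Build R[i] envelope env_scaleAr.

Lemma gen_lin a x y : gen (a *: x + y) = a *: gen x + gen y.
Proof. by rewrite /gen -upiZ -upiD; apply/envelope_eqP/ucong_gen_lin. Qed.

Lemma gen_lie x y : gen (lie x y) = gen x * gen y - gen y * gen x.
Proof.
rewrite /gen -!upiM -scaleN1r -upiZ -upiD.
exact/envelope_eqP/ucong_gen_lie.
Qed.

End Envelope.

Section EnvelopeLift.
Context {R : realType} {g : lieAlgebra R} {A : algType R[i]} (f : g -> A).

Fixpoint ueval (s : uterm g) : A :=
  match s with
  | UGen x => f x
  | UZero => 0
  | UOne => 1
  | UAdd s t => ueval s + ueval t
  | UMul s t => ueval s * ueval t
  | UScale a s => a *: ueval s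
  end.

Definition envelope_lift (z : envelope g) : A := ueval (repr z).

Context (f_lin : forall a x y, f (a *: x + y) = a *: f x + f y).
Context (f_lie : forall x y, f (lie x y) = f x * f y - f y * f x).

Lemma ueval_cong s t : ucong s t -> ueval s = ueval t.
Proof.
elim=> //=.
- by move=> s' t' u _ -> _ ->.
- by move=> s1 s2 t1 t2 _ -> _ ->.
- by move=> s1 s2 t1 t2 _ -> _ ->.
- by move=> a s1 s2 _ ->.
- by move=> *; rewrite addrA.
- by move=> *; rewrite addrC.
- by move=> *; rewrite add0r.
- by move=> *; rewrite scaleN1r addNr.
- by move=> *; rewrite scalerA.
- by move=> *; rewrite scale1r.
- by move=> *; rewrite scalerDr.
- by move=> *; rewrite scalerDl.
- by move=> *; rewrite mulrA.
- by move=> *; rewrite mul1r.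
- by move=> *; rewrite mulr1.
- by move=> *; rewrite mulrDl.
- by move=> *; rewrite mulrDr.
- by move=> *; rewrite scalerAl.
- by move=> *; rewrite scalerAr.
- by move=> *; rewrite scaleN1r.
Qed.

Lemma envelope_lift_pi s : envelope_lift (\pi_(envelope g) s) = ueval s.
Proof. exact/ueval_cong/envelope_reprP. Qed.

End EnvelopeLift.

Section EnvelopeAction.
Context {R : realType} {g : lieAlgebra R} {M : lieModule g}.

Fixpoint uterm_act (s : uterm g) (v : M) : M :=
  match s with
  | UGen x => act x v
  | UZero => 0
  | UOne => v
  | UAdd s t => uterm_act s v + uterm_act t v
  | UMul s t => uterm_act s (uterm_act t v)
  | UScale a s => a *: uterm_act s v
  end.

Definition env_act (u : envelope g) (v : M) : M := uterm_act (repr u) v.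

Lemma uterm_act_lin s a v w :
  uterm_act s (a *: v + w) = a *: uterm_act s v + uterm_act s w.
Proof.
elim: s a v w => [x||| s IHs t IHt|s IHs t IHt|b s IHs] a v w //=.
- exact: act_linr.
- by rewrite scaler0 addr0.
- by rewrite IHs IHt scalerDr addrACA.
- by rewrite IHt IHs.
- by rewrite IHs scalerDr !scalerA mulrC.
Qed.

Lemma uterm_act0 s : uterm_act s 0 = 0.
Proof.
have := uterm_act_lin s 1 0 0; rewrite !scale1r addr0 => /eqP.
by rewrite -subr_eq0 opprD addrA subrr sub0r oppr_eq0 => /eqP.
Qed.

Lemma uterm_act_cong s t : ucong s t -> uterm_act s =1 uterm_act t.
Proof.
elim=> //=.
- by move=> s' t' _ IH v.
- by move=> s' t' u _ IH1 _ IH2 v; rewrite IH1 IH2.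
- by move=> s1 s2 t1 t2 _ IH1 _ IH2 v; rewrite IH1 IH2.
- by move=> s1 s2 t1 t2 _ IH1 _ IH2 v; rewrite IH2 IH1.
- by move=> a s1 s2 _ IH v; rewrite IH.
- by move=> s1 s2 s3 v; rewrite addrA.
- by move=> s1 s2 v; rewrite addrC.
- by move=> s1 v; rewrite add0r.
- by move=> s1 v; rewrite scaleN1r addNr.
- by move=> a b s1 v; rewrite scalerA.
- by move=> s1 v; rewrite scale1r.
- by move=> a s1 s2 v; rewrite scalerDr.
- by move=> a b s1 v; rewrite scalerDl.
- by move=> s1 s2 s3 v; rewrite -{1}[uterm_act s2 v]scale1r uterm_act_lin scale1r.
- by move=> a s1 s2 v; rewrite -[a *: uterm_act s2 v]addr0 uterm_act_lin uterm_act0 addr0.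
- by move=> a x y v; exact: act_linl.
- by move=> x y v; rewrite act_lie scaleN1r.
Qed.

Lemma env_act_pi s v : env_act (\pi_(envelope g) s) v = uterm_act s v.
Proof. exact/uterm_act_cong/envelope_reprP. Qed.

End EnvelopeAction.

Section EnvelopeMap.
Context {R : realType} {g : lieAlgebra R} (n : lieSubalgebra g).

(** The algebra morphism U(n) -> U(g) induced by the inclusion. *)
Definition env_incl : envelope n -> envelope g :=
  envelope_lift (fun x : n => gen (lsub_val x)).

Lemma env_incl_pi s :
  env_incl (\pi_(envelope n) s) = ueval (fun x : n => gen (lsub_val x)) s.
Proof.
apply: envelope_lift_pi => [a x y|x y]; first exact: gen_lin.
exact: gen_lie.
Qed.

End EnvelopeMap.

Section TensorModule.
Context {R : realType} {g : lieAlgebra R} (V L : lieModule g).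

Definition vtensor : lmodType R[i] :=
  tensor (fun (v : V) (a : R[i]) => a *: v) (fun (a : R[i]) (l : L) => a *: l).

Definition vpure (v : V) (l : L) : vtensor := pure _ _ v l.

Definition tensor_act (x : g) : vtensor -> vtensor :=
  tensor_lift (fun v l => vpure (act x v) l + vpure v (act x l)).

Lemma vpure_linl a v v' l : vpure (a *: v + v') l = a *: vpure v l + vpure v' l.
Proof. exact: pure_linl. Qed.
Lemma vpure_linr a v l l' : vpure v (a *: l + l') = a *: vpure v l + vpure v l'.
Proof. exact: pure_linr. Qed.
Lemma vpureZ a v l : vpure (a *: v) l = vpure v (a *: l).
Proof. exact: pure_balance. Qed.

Fact actZ (M : lieModule g) x a (v : M) : act x (a *: v) = a *: act x v.
Proof.
have act0 : act x (0 : M) = 0.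
  have := act_linr 1 x (0 : M) 0; rewrite !scale1r addr0 => /eqP.
  by rewrite -subr_eq0 opprD addrA subrr sub0r oppr_eq0 => /eqP.
by rewrite -[a *: v]addr0 act_linr act0 addr0.
Qed.

Lemma vtensor_ind (P : vtensor -> Prop) :
  (forall v l, P (vpure v l)) -> P 0 -> (forall z w, P z -> P w -> P (z + w)) ->
  (forall a z, P z -> P (a *: z)) -> forall z, P z.
Proof. exact: tensor_ind. Qed.

Fact tensor_act_balanced x :
  balanced (fun (v : V) (a : R[i]) => a *: v) (fun (a : R[i]) (l : L) => a *: l)
    (fun v l => vpure (act x v) l + vpure v (act x l)).
Proof.
split=> [a v v' l|a v l l'|v a l].
- by rewrite act_linr !vpure_linl scalerDr addrACA.
- by rewrite act_linr !vpure_linr scalerDr addrACA.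
- by rewrite !actZ !vpureZ.
Qed.

Lemma tensor_act_pure x v l :
  tensor_act x (vpure v l) = vpure (act x v) l + vpure v (act x l).
Proof. exact: tensor_lift_pure (tensor_act_balanced x) _ _. Qed.

Fact tensor_act_linr a x z w :
  tensor_act x (a *: z + w) = a *: tensor_act x z + tensor_act x w.
Proof. exact: tensor_lift_linear (tensor_act_balanced x) _ _ _. Qed.

Fact tensor_act0 x : tensor_act x 0 = 0.
Proof.
have := tensor_act_linr 1 x 0 0; rewrite !scale1r addr0 => /eqP.
by rewrite -subr_eq0 opprD addrA subrr sub0r oppr_eq0 => /eqP.
Qed.
Fact tensor_actD x z w : tensor_act x (z + w) = tensor_act x z + tensor_act x w.
Proof. by rewrite -{1}[z]scale1r tensor_act_linr scale1r. Qed.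
Fact tensor_actZ x a z : tensor_act x (a *: z) = a *: tensor_act x z.
Proof. by rewrite -[a *: z]addr0 tensor_act_linr tensor_act0 addr0. Qed.

Fact tensor_act_linl a x y z :
  tensor_act (a *: x + y) z = a *: tensor_act x z + tensor_act y z.
Proof.
elim/vtensor_ind: z => [v l||z w IHz IHw|b z IHz].
- rewrite !tensor_act_pure !act_linl vpure_linl vpure_linr.
  by rewrite scalerDr addrACA.
- by rewrite !tensor_act0 scaler0 addr0.
- by rewrite !tensor_actD IHz IHw scalerDr addrACA.
- by rewrite !tensor_actZ IHz scalerDr !scalerA mulrC.
Qed.

Fact tensor_act_lie x y z :
  tensor_act (lie x y) z
  = tensor_act x (tensor_act y z) - tensor_act y (tensor_act x z).
Proof.
elim/vtensor_ind: z => [v l||z w IHz IHw|b z IHz].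
- rewrite !(tensor_act_pure, tensor_actD) !act_lie.
  have vpureBl v1 v2 l1 : vpure (v1 - v2) l1 = vpure v1 l1 - vpure v2 l1.
    by rewrite addrC -scaleN1r vpure_linl scaleN1r addrC.
  have vpureBr v1 l1 l2 : vpure v1 (l1 - l2) = vpure v1 l1 - vpure v1 l2.
    by rewrite addrC -scaleN1r vpure_linr scaleN1r addrC.
  rewrite vpureBl vpureBr (addrACA _ _ (vpure (act x v) _)) opprD [RHS]addrACA.
  by rewrite [in RHS](addrC (vpure (act y (act x v)) l)) addrKA
    [in RHS](addrC (vpure (act y v) (act x l))) addrKA.
- by rewrite !tensor_act0 subr0.
- by rewrite !tensor_actD IHz IHw opprD addrACA.
- by rewrite !tensor_actZ IHz scalerBr.
Qed.

Definition tensor_module : lieModule g :=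
  LieModule tensor_act_linl (fun a x => tensor_act_linr a x) tensor_act_lie.

End TensorModule.

Section Induced.
Context {R : realType} {g : lieAlgebra R} (n : lieSubalgebra g) (N : lieModule n).

Let ra (u : envelope g) (a : envelope n) : envelope g := u * env_incl a.
Let la (a : envelope n) (v : N) : N := env_act a v.

Definition ind_space : lmodType R[i] := tensor ra la.

Definition ipure (u : envelope g) (v : N) : ind_space := pure ra la u v.

Lemma ipure_linl a u u' v : ipure (a *: u + u') v = a *: ipure u v + ipure u' v.
Proof. exact: pure_linl. Qed.
Lemma ipure_linr a u v v' : ipure u (a *: v + v') = a *: ipure u v + ipure u v'.
Proof. exact: pure_linr. Qed.
Lemma ipure_balance u a v : ipure (u * env_incl a) v = ipure u (env_act a v).
Proof. exact: (pure_balance ra la). Qed.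

Lemma ind_space_ind (P : ind_space -> Prop) :
  (forall u v, P (ipure u v)) -> P 0 -> (forall z w, P z -> P w -> P (z + w)) ->
  (forall a z, P z -> P (a *: z)) -> forall z, P z.
Proof. exact: tensor_ind. Qed.

Definition ind_act (x : g) : ind_space -> ind_space :=
  tensor_lift (fun u v => ipure (gen x * u) v).

Fact ind_act_balanced x : balanced ra la (fun u v => ipure (gen x * u) v).
Proof.
split=> [a u u' v|a u v v'|u a v].
- by rewrite mulrDr -scalerAr ipure_linl.
- by rewrite ipure_linr.
- by rewrite mulrA ipure_balance.
Qed.

Lemma ind_act_pure x u v : ind_act x (ipure u v) = ipure (gen x * u) v.
Proof. exact: tensor_lift_pure (ind_act_balanced x) _ _. Qed.

Fact ind_act_linr a x z w : ind_act x (a *: z + w) = a *: ind_act x z + ind_act x w.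
Proof. exact: tensor_lift_linear (ind_act_balanced x) _ _ _. Qed.

Fact ind_act0 x : ind_act x 0 = 0.
Proof.
have := ind_act_linr 1 x 0 0; rewrite !scale1r addr0 => /eqP.
by rewrite -subr_eq0 opprD addrA subrr sub0r oppr_eq0 => /eqP.
Qed.
Fact ind_actD x z w : ind_act x (z + w) = ind_act x z + ind_act x w.
Proof. by rewrite -{1}[z]scale1r ind_act_linr scale1r. Qed.
Fact ind_actZ x a z : ind_act x (a *: z) = a *: ind_act x z.
Proof. by rewrite -[a *: z]addr0 ind_act_linr ind_act0 addr0. Qed.

Fact ind_act_linl a x y z : ind_act (a *: x + y) z = a *: ind_act x z + ind_act y z.
Proof.
elim/ind_space_ind: z => [u v||z w IHz IHw|b z IHz].
- by rewrite !ind_act_pure gen_lin mulrDl -scalerAl ipure_linl.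
- by rewrite !ind_act0 scaler0 addr0.
- by rewrite !ind_actD IHz IHw scalerDr addrACA.
- by rewrite !ind_actZ IHz scalerDr !scalerA mulrC.
Qed.

Fact ind_act_lie x y z :
  ind_act (lie x y) z = ind_act x (ind_act y z) - ind_act y (ind_act x z).
Proof.
elim/ind_space_ind: z => [u v||z w IHz IHw|b z IHz].
- rewrite !ind_act_pure gen_lie mulrBl !mulrA addrC -scaleN1r ipure_linl.
  by rewrite scaleN1r addrC.
- by rewrite !ind_act0 subr0.
- by rewrite !ind_actD IHz IHw opprD addrACA.
- by rewrite !ind_actZ IHz scalerBr.
Qed.

Definition induced : lieModule g :=
  LieModule ind_act_linl (fun a x => ind_act_linr a x) ind_act_lie.

End Induced.

Section Multiplicity.
Context {R : realType} {g : lieAlgebra R}.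
Implicit Types M X L : lieModule g.

Definition findim_module M : Prop := findim [set: M].

Definition simple M : Prop :=
  (exists v : M, v <> 0) /\
  forall W : set M, is_submodule W -> W = [set 0] \/ W = setT.

Definition indecomposable M : Prop :=
  (exists v : M, v <> 0) /\
  forall A B : set M, is_submodule A -> is_submodule B ->
    A `&` B = [set 0] -> (forall v, exists a b, A a /\ B b /\ v = a + b) ->
    A = [set 0] \/ B = [set 0].

Definition locally_finite M : Prop :=
  forall v : M, findim [set env_act u v | u in [set: envelope g]].

(** 0 = W 0, ..., W k = X; the values of [W] beyond [k] are irrelevant. *)
Definition composition_series X (k : nat) (W : nat -> set X)
    (h : forall i, is_submodule (W i)) : Prop :=
  [/\ W 0%N = [set 0], W k = setT &
      forall i, (i < k)%N ->
        W i `<=` W i.+1 /\ simple (subquotient (h i) (h i.+1))].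

(** [X : L] for a finite dimensional X: the number of factors isomorphic to L in
    a composition series. By Jordan-Hoelder all series give the same number. *)
Definition jh_mult X L : nat :=
  xget 0%N [set m | exists k W (h : forall i, is_submodule (W i)),
    @composition_series X k W h /\
    m = #|[set i : 'I_k | `[< isomorphic (subquotient (h i) (h i.+1)) L >]]%SET|].

Definition findim_filtration M (W : nat -> set M) : Prop :=
  [/\ W 0%N = [set 0], forall i, W i `<=` W i.+1,
      forall i, findim (W i) & \bigcup_i W i = setT].

(** [M : L] for a locally finite M of countable dimension: the supremum of the
    [M_i : L] along a filtration by finite dimensional submodules. All such
    filtrations give the same value. *)
Definition mult M L : \bar R :=
  xget 0%E [set m | exists W (h : forall i, is_submodule (W i)),
    @findim_filtration M W /\
    m = ereal_sup (range (fun i => ((jh_mult (submodule (h i)) L)%:R)%:E))].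

End Multiplicity.

Section Blocks.
Context {R : realType} {g : lieAlgebra R} (n : lieSubalgebra g).

Record irrep := Irrep {
  irrep_module :> lieModule n;
  irrep_simple : simple irrep_module;
  irrep_findim : findim_module irrep_module }.

Definition Irr : Type :=
  {X : irrep -> Prop | exists L : irrep, X = (fun S : irrep => isomorphic L S)}.

Definition iso_class (L : irrep) : Irr :=
  exist _ (fun S : irrep => isomorphic L S) (ex_intro _ L erefl).

Fact subalgebra_submodule :
  is_submodule (lsub_set n : set (restriction n (adjoint g))).
Proof.
split; first exact: lsub_subspace.
by move=> x v nv; apply: lsub_lie => //; exact: (ss_valP (h := lsub_subspace n)).
Qed.

Definition adjoint_quotient : lieModule n := quotient_module subalgebra_submodule.

Inductive linked : Irr -> Irr -> Prop :=
  | linked_indecomposable (L S : irrep) (M : lieModule n) :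
      findim_module M -> indecomposable M ->
      jh_mult M L <> 0%N -> jh_mult M S <> 0%N ->
      linked (iso_class L) (iso_class S)
  | linked_adjoint (L S : irrep) :
      mult (tensor_module adjoint_quotient L) S <> 0%E ->
      linked (iso_class L) (iso_class S)
  | linked_refl X : linked X X
  | linked_sym X Y : linked X Y -> linked Y X
  | linked_trans X Y Z : linked X Y -> linked Y Z -> linked X Z.

Definition block : Type :=
  {I : Irr -> Prop | exists X : Irr, I = (fun Y : Irr => linked X Y)}.

Definition in_block (L : irrep) (I : block) : Prop := proj1_sig I (iso_class L).

(** M_I: the trace in M of the modules induced from the finite dimensional
    n-modules with all composition factors in I. *)
Definition block_part (M : lieModule g) (I : block) : set M :=
  lspan [set v | exists (N : lieModule n) (f : lieHom (induced N) M),
    [/\ findim_module N,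
        forall L : irrep, jh_mult N L <> 0%N -> in_block L I & range f v]].

End Blocks.
Arguments block_part {R g n} M I.

Definition in_category (R : realType) (g : lieAlgebra R) (n : lieSubalgebra g)
    (M : lieModule g) : Prop :=
  locally_finite (restriction n M).

(* Main.v *)
(** An [n]-module [X] that is locally finite is the direct sum of its isotypic parts
    X^I = { v | all simple subquotients of U(n) v lie in I }: the sum is direct
    because a nonzero vector always has a simple subquotient, and it is everything
    because a finite dimensional module is a sum of indecomposables, each of which
    has all its constituents in a single block by (I).  For a [g]-module the parts
    are [g]-stable: the constituents of g N lie in those of N and of
    (g / n) (x) N, and (II) applies to the simple factors of N.  Frobenius
    reciprocity then identifies the trace M_I with M^I. *)

Require Import Defs.
From HB Require Import structures.
From mathcomp Require Import all_boot all_order all_algebra.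
From mathcomp Require Import complex.
From mathcomp Require Import boolp classical_sets functions reals ereal.

Set Implicit Arguments.
Unset Strict Implicit.
Unset Printing Implicit Defensive.

Import Order.TTheory GRing.Theory Num.Theory.
Local Open Scope quotient_scope.
Local Open Scope classical_set_scope.
Local Open Scope ring_scope.

(** The numbers [jh_mult] and [mult] are selected by choice among all series or filtrations, and
    linkage, blocks and the trace only ask whether they vanish. They are therefore replaced by
    [occurs], which says that [L] is a subquotient of a given submodule and refers to no series. The
    main obstacle is stability under g. Condition (II) speaks of (g / n) (x) S for simple S only,
    whereas N = U(n) v may have any length; moreover y w, for y in g, is not determined by the class
    of y modulo n. Both difficulties disappear along a composition series W_i of N: modulo N + g
    W_i, the product y w with w in W_{i+1} depends only on the classes of y in g / n and of w in
    W_{i+1} / W_i. *)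

(** * Spans and dimension bounds for subspaces *)

Section Span.
Context {R : realType}.
Implicit Types V U : lmodType R[i].

Lemma subspaceB V (W : set V) x y : is_subspace W -> W x -> W y -> W (x - y).
Proof.
by move=> hW Wx Wy; apply: is_subspaceD => //; apply: is_subspaceN.
Qed.

Lemma subspace_sum V (W : set V) k (e : 'I_k -> V) :
  is_subspace W -> (forall i, W (e i)) -> W (\sum_(i < k) e i).
Proof.
move=> hW We; elim/big_ind: _ => //; first exact: hW.1.
by move=> x y; exact: is_subspaceD.
Qed.

Lemma sub_lspan V (A : set V) : A `<=` lspan A.
Proof.
move=> x Ax; exists 1%N, (fun=> 1), (fun=> x); split=> //.
by rewrite big_ord1 scale1r.
Qed.

Lemma lspan_subspace V (A : set V) : is_subspace (lspan A).
Proof.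
split; first by exists 0%N, (fun=> 0), (fun=> 0); split=> [[]//|]; rewrite big_ord0.
move=> a _ _ [k [c [e [Ae ->]]]] [k' [c' [e' [Ae' ->]]]].
exists (k + k')%N,
  (fun i : 'I_(k + k') =>
     match fintype.split i with inl j => a * c j | inr j => c' j end),
  (fun i : 'I_(k + k') =>
     match fintype.split i with inl j => e j | inr j => e' j end); split.
  by move=> i; case: (fintype.split i).
rewrite big_split_ord /= scaler_sumr; congr (_ + _); apply: eq_bigr => i _.
  by rewrite (unsplitK (inl i)) scalerA.
by rewrite (unsplitK (inr i)).
Qed.

Lemma lspan_min V (A W : set V) : is_subspace W -> A `<=` W -> lspan A `<=` W.
Proof.
move=> hW AW _ [k [c [e [Ae ->]]]]; apply: subspace_sum => // i.
exact/is_subspaceZ/AW.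
Qed.

Lemma subspace0 V : is_subspace ([set 0] : set V).
Proof. by split=> // a x y -> ->; rewrite scaler0 addr0. Qed.

Definition linear_map V U (f : V -> U)
    (f_lin : forall a x y, f (a *: x + y) = a *: f x + f y) : {linear V -> U} :=
  HB.pack f (GRing.isLinear.Build R[i] V U *:%R f f_lin).

Lemma lspan_image V U (f : {linear V -> U}) (A : set V) v :
  lspan A v -> lspan (f @` A) (f v).
Proof.
move=> [k [c [e [Ae ->]]]]; exists k, c, (f \o e); split.
  by move=> i; exists (e i).
by rewrite linear_sum; apply: eq_bigr => i _; rewrite linearZ.
Qed.

(** [W] is spanned by [k] vectors; the recursion makes the exchange argument a
    plain induction. *)
Fixpoint fd V k (W : set V) : Prop :=
  if k is k'.+1 then
    exists (W' : set V) (e : V),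
      fd k' W' /\ W = [set w | exists c, W' (w - c *: e)]
  else W = [set 0].

Lemma fd_subspace V k (W : set V) : fd k W -> is_subspace W.
Proof.
elim: k W => [|k IH] W /=; first by move->; exact: subspace0.
move=> [W' [e [/IH hW' ->]]]; split.
  by exists 0; rewrite scale0r subr0; exact: hW'.1.
move=> a x y [c Wx] [d Wy]; exists (a * c + d).
by rewrite scalerDl -scalerA opprD addrACA -scalerBr; exact: hW'.2.
Qed.

(** [fd k] only bounds the dimension: an added generator may already lie in the smaller space, here
    0. *)
Lemma fd_pad V k l (W : set V) : (k <= l)%N -> fd k W -> fd l W.
Proof.
move=> /subnK <-; elim: (l - k)%N => // m IH /IH Wm; exists W, 0; split=> //.
apply/seteqP; split=> x; first by exists 0; rewrite scaler0 subr0.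
by move=> [c]; rewrite scaler0 subr0.
Qed.

(** Exchange argument: if [A] is not inside [W'], a vector of [A] replaces [e] as last generator of
    [W], and the induction applies to the trace of [A] on [W']. The strict drop of the bound is the
    termination measure for all later descents. *)
Lemma fd_sub_proper V k (A W : set V) : is_subspace A -> A `<=` W -> fd k W ->
  A = W \/ exists2 l, (l < k)%N & fd l A.
Proof.
elim: k A W => [|k IH] A W hA AW.
  move=> /= W0; left; apply/seteqP; split=> // x.
  by rewrite W0 => ->; exact: hA.1.
move=> [W' [e [fW' WE]]].
have hW' := fd_subspace fW'.
have [AW'|] := pselect (A `<=` W').
  right; have [->|[l lk fA]] := IH _ _ hA AW' fW'; first by exists k.
  by exists l => //; exact: ltnW.
move=> /existsNP [a /not_implyP [Aa W'a]].
have [c Wa] : exists c, W' (a - c *: e) by have := AW _ Aa; rewrite WE.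
have c0 : c != 0.
  by apply: contra_notN W'a => /eqP c0; move: Wa; rewrite c0 scale0r subr0.
have decomp x : W x -> exists d, W' (x - d *: a).
  (* Modulo [W'], [x] is [d *: e] and [a] is [c *: e], so this multiple of [a] cancels the
     [e]-component. *)
  rewrite WE => -[d Wx]; exists (d / c).
  rewrite (_ : _ - _ = (x - d *: e) - (d / c) *: (a - c *: e)).
    by apply: subspaceB => //; exact: is_subspaceZ.
  by rewrite scalerBr scalerA divfK // opprB addrA subrK.
have hAW' : is_subspace (A `&` W').
  split; first by split; [exact: hA.1|exact: hW'.1].
  by move=> b x y [? ?] [? ?]; split; [exact: hA.2|exact: hW'.2].
have AE : A = [set w | exists d, (A `&` W') (w - d *: a)].
  apply/seteqP; split=> x.
    move=> Ax; have [d Wx] := decomp _ (AW _ Ax); exists d; split=> //.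
    by apply: subspaceB => //; exact: is_subspaceZ.
  move=> [d [Ax _]]; rewrite -(subrK (d *: a) x).
  by apply: is_subspaceD => //; exact: is_subspaceZ.
have [E|[l lk fA]] := IH _ _ hAW' (@subIsetr _ A W') fW'.
  left; apply/seteqP; split=> // x /decomp [d Wx]; rewrite AE; exists d.
  by rewrite E.
by right; exists l.+1 => //; exists (A `&` W'), a.
Qed.

Lemma fd_sub V k (A W : set V) : is_subspace A -> A `<=` W -> fd k W -> fd k A.
Proof.
move=> hA AW fW; have [->//|[l lk]] := fd_sub_proper hA AW fW.
exact/fd_pad/ltnW.
Qed.

Lemma fd_image V U k (W : set V) (f : {linear V -> U}) :
  fd k W -> fd k (f @` W).
Proof.
elim: k W => [|k IH] W /=; first by move=> ->; rewrite image_set1 linear0.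
move=> [W' [e [fW' ->]]]; exists (f @` W'), (f e); split; first exact: IH.
apply/seteqP; split=> x.
  by move=> [y [c Wy] <-]; exists c; exists (y - c *: e) => //; rewrite linearB linearZ.
move=> [c [y Wy yE]]; exists (y + c *: e); first by exists c; rewrite addrK.
by rewrite linearD linearZ /= yE subrK.
Qed.

Lemma fd_ss V (W : set V) (h : is_subspace W) k : fd k W -> fd k [set: Defs.subspace h].
Proof.
(* The recursion of [fd] runs through smaller subspaces, while the type built on [W] must stay
   fixed. *)
suff H W' : W' `<=` W -> fd k W' -> fd k [set x : Defs.subspace h | W' (ss_val x)].
  move=> fW; rewrite (_ : setT = [set x : Defs.subspace h | W (ss_val x)]).
    exact: H.
  by apply/seteqP; split=> // x _; exact: ss_valP.
elim: k W' => [|k IH] W' W'W /=.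
  by move=> ->; apply/seteqP; split=> x /= => [x0|->//]; exact: ss_inj.
move=> [W'' [e [fW'' E]]]; have hW'' := fd_subspace fW''.
have We : W e by apply: W'W; rewrite E; exists 1; rewrite scale1r subrr; exact: hW''.1.
exists [set x : Defs.subspace h | W'' (ss_val x)], (ss_mk h We); split.
  apply: IH => // x Wx; apply: W'W; rewrite E; exists 0.
  by rewrite scale0r subr0.
by rewrite E.
Qed.

Lemma fdD V k l (A B : set V) :
  fd k A -> fd l B -> fd (l + k) [set w | exists a b, [/\ A a, B b & w = a + b]].
Proof.
move=> fA; elim: l B => [|l IH] B /=.
  move=> ->; rewrite (_ : [set _ | _] = A) //; apply/seteqP; split=> x.
    by move=> [a [b [? -> ->]]]; rewrite addr0.
  by move=> Ax; exists x, 0; rewrite addr0.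
move=> [B' [e [fB' ->]]]; eexists; exists e; split; first exact: IH fB'.
apply/seteqP; split=> x.
  move=> [a [b [Aa [c Bb] ->]]]; exists c, a, (b - c *: e); split=> //.
  by rewrite addrA.
move=> [c [a [b [Aa Bb /eqP]]]]; rewrite subr_eq => /eqP ->.
by exists a, (b + c *: e); rewrite addrA; split=> //; exists c; rewrite addrK.
Qed.

Lemma fd_lspan V k (e : 'I_k -> V) : fd k (lspan (range e)).
Proof.
elim: k e => [|k IH] e.
  apply/seteqP; split=> x; last by move=> ->; exact: (lspan_subspace _).1.
  by apply: lspan_min; [exact: subspace0|move=> y [[i lti]]].
exists (lspan (range (fun i => e (lift ord0 i)))), (e ord0); split=> //.
apply/seteqP; split; last first.
  move=> x [c Wx]; rewrite -(subrK (c *: e ord0) x).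
  apply: is_subspaceD; first exact: lspan_subspace.
    apply: lspan_min Wx; first exact: lspan_subspace.
    by move=> _ [i _ <-]; apply: sub_lspan; exists (lift ord0 i).
  by apply: is_subspaceZ; [exact: lspan_subspace|apply: sub_lspan; exists ord0].
have f1 : fd k.+1 [set w | exists c,
    lspan (range (fun i => e (lift ord0 i))) (w - c *: e ord0)].
  by exists (lspan (range (fun i => e (lift ord0 i)))), (e ord0).
apply: lspan_min; first exact: fd_subspace f1.
move=> _ [i _ <-]; have [j ->|->] := unliftP ord0 i.
  by exists 0; rewrite scale0r subr0; apply: sub_lspan; exists j.
by exists 1; rewrite scale1r subrr; exact: (lspan_subspace _).1.
Qed.

Lemma findimP V (W : set V) : findim W <-> exists k, fd k W.
Proof.
split=> [[k [e ->]]|[k]]; first by exists k; exact: fd_lspan.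
elim: k W => [|k IH] W /=.
  move=> ->; exists 0%N, (fun=> 0); apply/seteqP; split=> x.
    by move=> ->; exact: (lspan_subspace _).1.
  by apply: lspan_min => [|y [[i lti]]//]; exact: subspace0.
move=> [W' [e [/IH [l [b W'E]] ->]]].
exists l.+1, (fun i => if unlift ord0 i is Some j then b j else e).
apply/seteqP; split=> x.
  move=> [c W'x]; rewrite -(subrK (c *: e) x).
  apply: is_subspaceD; first exact: lspan_subspace.
    move: W'x; rewrite W'E; apply: lspan_min; first exact: lspan_subspace.
    by move=> _ [i _ <-]; apply: sub_lspan; exists (lift ord0 i); rewrite ?liftK.
  apply: is_subspaceZ; first exact: lspan_subspace.
  by apply: sub_lspan; exists ord0; rewrite ?unlift_none.
have f1 : fd l.+1 [set w | exists c, W' (w - c *: e)].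
  by exists W', e; split=> //; rewrite W'E; exact: fd_lspan.
apply: lspan_min; first exact: fd_subspace f1.
have h' : is_subspace W' by rewrite W'E; exact: lspan_subspace.
move=> _ [i _ <-]; case: unliftP => [j _|_].
  by exists 0; rewrite scale0r subr0 W'E; apply: sub_lspan; exists j.
by exists 1; rewrite scale1r subrr; exact: h'.1.
Qed.

End Span.

(** * Subquotients as equivariant relations *)

Section Modules.
Context {R : realType} {g : lieAlgebra R}.
Implicit Types M N X L : lieModule g.

Lemma actD M x (v w : M) : act x (v + w) = act x v + act x w.
Proof. by rewrite -{1}[v]scale1r act_linr scale1r. Qed.

Lemma act0 M x : act x (0 : M) = 0.
Proof. by rewrite -[0 in LHS](scale0r 0) actZ scale0r. Qed.

Lemma actB M x (v w : M) : act x (v - w) = act x v - act x w.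
Proof. by rewrite actD -scaleN1r actZ scaleN1r. Qed.

Lemma act_subl M x y (v : M) : act (x - y) v = act x v - act y v.
Proof. by rewrite addrC -scaleN1r act_linl scaleN1r addrC. Qed.

Lemma submodule0 M : is_submodule ([set 0] : set M).
Proof. by split; [exact: subspace0|move=> x v ->; exact: act0]. Qed.

Lemma submoduleT M : is_submodule [set: M].
Proof. by []. Qed.

Lemma lspan_submodule M (A : set M) :
  (forall x t, A t -> lspan A (act x t)) -> is_submodule (lspan A).
Proof.
move=> hA; split=> [|x t]; first exact: lspan_subspace.
apply: (@lspan_min _ _ _ [set t | lspan A (act x t)]) => [|t' At']; last exact: hA.
split=> [|a y z Sy Sz]; first by rewrite /= act0; exact: (lspan_subspace _).1.
by rewrite /= act_linr; exact: (lspan_subspace _).2.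
Qed.

Definition lie_hom M N (f : M -> N)
    (f_lin : forall a x y, f (a *: x + y) = a *: f x + f y)
    (f_act : forall x v, f (act x v) = act x (f v)) : lieHom M N :=
  @LieHom R g M N (linear_map f_lin) f_act.

Lemma hom_lin M N (f : {linear M -> N}) a x y : f (a *: x + y) = a *: f x + f y.
Proof. exact: linearP. Qed.

Section Val.
Context {M : lieModule g} {W : set M} (h : is_submodule W).

Definition val_hom : lieHom (submodule h) M :=
  @lie_hom (submodule h) M (@ss_val _ _ _ h.1) (fun _ _ _ => erefl)
    (fun _ _ => erefl).

Lemma val_hom_inj : injective val_hom.
Proof. exact: ss_inj. Qed.

Lemma val_homP s : W (val_hom s).
Proof. exact: ss_valP. Qed.

Lemma val_hom_surj x : W x -> exists s, val_hom s = x.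
Proof. by move=> Wx; exists (ss_mk h.1 Wx). Qed.

Let quo_map (x : M) : quotient_module h := \pi_(quotient_space h.1) x.

Fact quo_map_lin a x y : quo_map (a *: x + y) = a *: quo_map x + quo_map y.
Proof. exact: pi_is_linear. Qed.

Fact quo_map_act x v : quo_map (act x v) = act x (quo_map v).
Proof. by rewrite [RHS]quo_act_pi. Qed.

Definition quo_hom : lieHom M (quotient_module h) := lie_hom quo_map_lin quo_map_act.

Lemma quo_hom_eq0 x : quo_hom x = 0 <-> W x.
Proof.
rewrite -{2}(subr0 x); exact: (qs_eqP h.1 x 0).
Qed.

Lemma quo_hom_surj q : exists x, quo_hom x = q.
Proof. by have [x ->] := qs_surj (q : quotient_space h.1); exists x. Qed.

End Val.

Section Subq.
Context {M : lieModule g} {A B : set M} (hA : is_submodule A) (hB : is_submodule B).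

Definition subq_hom : lieHom (submodule hB) (subquotient hA hB) :=
  quo_hom (sub_preimage_submodule hA hB).

Lemma subq_hom_eq0 s : subq_hom s = 0 <-> A (val_hom hB s).
Proof. exact: quo_hom_eq0. Qed.

Lemma subq_hom_surj q : exists s, subq_hom s = q.
Proof. exact: quo_hom_surj. Qed.

End Subq.

(** Submodules of the direct sum of [M] and [N]. Graphs of homomorphisms and their converses are
    both of this kind, so quotient maps and inclusions are treated alike. *)
Record arel M N (r : M -> N -> Prop) : Prop := Arel {
  arel0 : r 0 0;
  arel_lin : forall a x x' y y', r x y -> r x' y' -> r (a *: x + x') (a *: y + y');
  arel_act : forall z x y, r x y -> r (act z x) (act z y) }.

Lemma arelB M N (r : M -> N -> Prop) x x' y y' :
  arel r -> r x y -> r x' y' -> r (x - x') (y - y').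
Proof.
move=> hr rx rx'; rewrite addrC -scaleN1r (addrC y) -(scaleN1r y').
exact: arel_lin.
Qed.

Lemma arel_graph M N (f : lieHom M N) : arel (fun x y => y = f x).
Proof.
split; first by rewrite linear0.
  by move=> a x x' _ _ -> ->; rewrite hom_lin.
by move=> z x _ ->; rewrite lhom_act.
Qed.

Lemma arel_converse M N (f : lieHom M N) : arel (fun y x => y = f x).
Proof.
split; first by rewrite linear0.
  by move=> a _ _ x x' -> ->; rewrite hom_lin.
by move=> z _ x ->; rewrite lhom_act.
Qed.

Lemma arel_uterm M N (r : M -> N -> Prop) s x y :
  arel r -> r x y -> r (uterm_act s x) (uterm_act s y).
Proof.
move=> hr; elim: s x y => [z|||s IHs t IHt|s IHs t IHt|a s IHs] x y rxy //=.
- exact: arel_act.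
- exact: arel0.
- by rewrite -[uterm_act s x]scale1r -[uterm_act s y]scale1r; apply: arel_lin; auto.
- by apply: IHs; apply: IHt.
- rewrite -[a *: uterm_act s x]addr0 -[a *: uterm_act s y]addr0.
  by apply: (arel_lin hr); [exact: IHs|exact: arel0].
Qed.

Lemma hom_uterm M N (f : lieHom M N) s x :
  f (uterm_act s x) = uterm_act s (f x).
Proof. exact/esym/(arel_uterm _ (arel_converse f))/erefl. Qed.

(** [L] is isomorphic to a quotient of a submodule contained in [W]; encoding
    the subquotient by an equivariant relation makes transitivity a composition. *)
Definition occurs M (W : set M) L : Prop :=
  exists r : M -> L -> Prop, [/\ arel r, forall x l, r x l -> W x,
    forall l, r 0 l -> l = 0 & forall l, exists x, r x l].

Lemma occurs_comp M N (r : M -> N -> Prop) (W : set M) (A : set N) L :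
  arel r -> (forall x y, A y -> r x y -> W x) ->
  (forall y, A y -> r 0 y -> y = 0) -> (forall y, A y -> exists x, r x y) ->
  occurs A L -> occurs W L.
Proof.
move=> hr rW r0 rA [s [hs sA s0 sL]].
exists (fun x l => exists y, r x y /\ s y l); split.
- split; first by exists 0; split; exact: arel0.
    move=> a x x' l l' [y [rxy syl]] [y' [rxy' syl']].
    by exists (a *: y + y'); split; apply: arel_lin.
  by move=> z x l [y [rxy syl]]; exists (act z y); split; exact: arel_act.
- by move=> x l [y [rxy syl]]; apply: rW rxy; exact: sA syl.
- move=> l [y [ry syl]]; apply: s0; rewrite -(r0 y) //; exact: sA syl.
- move=> l; have [y syl] := sL l; have [x rxy] := rA _ (sA _ _ syl).
  by exists x, y.
Qed.

Lemma occurs_refl M : occurs [set: M] M.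
Proof.
exists (fun x y => y = x); split=> //; last by move=> y; exists y.
by split=> [//|a x x' _ _ -> ->|z x _ ->].
Qed.

Lemma occurs_sub M (A B : set M) L : A `<=` B -> occurs A L -> occurs B L.
Proof. by move=> AB [r [hr rA r0 rL]]; exists r; split=> // x l /rA /AB. Qed.

Lemma occurs_image M N (f : lieHom M N) (W : set M) L :
  is_submodule W -> occurs (f @` W) L -> occurs W L.
Proof.
move=> hW; apply: (occurs_comp (r := fun x y => W x /\ y = f x)).
- split; first by split; [exact: hW.1.1|rewrite linear0].
    by move=> a x x' _ _ [Wx ->] [Wx' ->]; split; [exact: hW.1.2|rewrite hom_lin].
  by move=> z x _ [Wx ->]; split; [exact: hW.2|rewrite lhom_act].
- by move=> x y _ [].
- by move=> y _ [_ ->]; rewrite linear0.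
- by move=> _ [x Wx <-]; exists x.
Qed.

Lemma occurs_preimage M N (f : lieHom M N) (W : set N) L :
  injective f -> occurs (f @^-1` W) L -> occurs W L.
Proof.
move=> fI; apply: (occurs_comp (arel_converse f)).
- by move=> x y Wy ->.
- by move=> y _; rewrite -(linear0 f) => /fI.
- by move=> y _; exists (f y).
Qed.

Lemma occurs_submodule M (W : set M) (h : is_submodule W) L :
  occurs [set: submodule h] L <-> occurs W L.
Proof.
split=> [o|[r [hr rW r0 rL]]].
  apply: (occurs_preimage (@val_hom_inj _ _ h)); apply: occurs_sub o => x _.
  exact: val_homP.
exists (fun s l => r (val_hom h s) l); split=> //.
- split; first by rewrite linear0; exact: arel0.
    by move=> a s s' l l' rs rs'; rewrite hom_lin; exact: arel_lin.
  by move=> z s l rs; rewrite lhom_act; exact: arel_act.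
- move=> l; have [x rxl] := rL l; have [s sx] := val_hom_surj h (rW _ _ rxl).
  by exists s; rewrite sx.
Qed.

Lemma occurs_subquotient M (A B : set M) (hA : is_submodule A)
    (hB : is_submodule B) L :
  occurs [set: subquotient hA hB] L -> occurs B L.
Proof.
move=> o; apply/(occurs_submodule hB).
apply: (occurs_image (f := subq_hom hA hB)) => //; apply: occurs_sub o => q _.
by have [s <-] := subq_hom_surj q; exists s.
Qed.

(** The vectors of [L] related to elements of [A] form a submodule of the simple module [L]. If it
    is 0, the relation descends to the quotient by [A]; if it is [L], the relation restricts to
    [A]. *)
Lemma occurs_quo M (A W : set M) (hA : is_submodule A) L : simple L ->
  occurs W L -> occurs A L \/ occurs (quo_hom hA @` W) L.
Proof.
move=> [_ sL] [r [hr rW r0 rL]].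
have hI : is_submodule [set l | exists a, A a /\ r a l].
  split; first split.
  - by exists 0; split; [exact: hA.1.1|exact: arel0].
  - move=> a x y [b [Ab rb]] [c [Ac rc]]; exists (a *: b + c); split.
      exact: hA.1.2.
    exact: arel_lin.
  - by move=> z l [a [Aa ra]]; exists (act z a); split; [exact: hA.2|exact: arel_act].
have [I0|IT] := sL _ hI; [right|left].
- exists (fun q l => exists x, quo_hom hA x = q /\ r x l); split.
  + split; first by exists 0; split; [rewrite linear0|exact: arel0].
      move=> a _ _ l l' [x [<- rx]] [x' [<- rx']]; exists (a *: x + x').
      by split; [rewrite hom_lin|exact: arel_lin].
    move=> z _ l [x [<- rx]]; exists (act z x).
    by split; [rewrite lhom_act|exact: arel_act].
  + by move=> _ l [x [<- rx]]; exists x => //; exact: rW rx.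
  + move=> l [x [/quo_hom_eq0 Ax rx]].
    by suff : [set 0] l by []; rewrite -I0; exists x.
  + by move=> l; have [x rx] := rL l; exists (quo_hom hA x), x.
- exists (fun x l => A x /\ r x l); split.
  + split; first by split; [exact: hA.1.1|exact: arel0].
      by move=> a x x' l l' [? ?] [? ?]; split; [exact: hA.1.2|exact: arel_lin].
    by move=> z x l [? ?]; split; [exact: hA.2|exact: arel_act].
  + by move=> x l [].
  + by move=> l [_ /r0].
  + by move=> l; have : setT l by []; rewrite -IT => -[x]; exists x.
Qed.

Lemma occurs_add M (A B : set M) L : is_submodule A -> is_submodule B -> simple L ->
  occurs [set w | exists a b, [/\ A a, B b & w = a + b]] L ->
  occurs A L \/ occurs B L.
Proof.
move=> hA hB sL /(occurs_quo hA sL) [|o]; [by left|right].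
apply: (occurs_image (f := quo_hom hA)) => //; apply: occurs_sub o.
move=> _ [_ [a [b [Aa Bb ->]]] <-]; exists b => //.
by rewrite linearD ((quo_hom_eq0 hA a).2 Aa) add0r.
Qed.

Lemma occurs_isomorphic X L : isomorphic X L -> occurs [set: X] L.
Proof.
move=> [f [f' fK f'K]]; exists (fun x l => l = f x); split=> //.
- exact: arel_graph.
- by move=> l ->; rewrite linear0.
- by move=> l; exists (f' l); rewrite f'K.
Qed.

(** Schur's argument: the domain of the relation and the vectors related to 0 are submodules of [X].
    As [L] is nonzero, they are [X] and 0, so the relation is the graph of an isomorphism. *)
Lemma simple_occurs_isomorphic X L (W : set X) :
  simple X -> simple L -> occurs W L -> isomorphic X L.
Proof.
move=> [_ sX] [[l0 l0n0] _] [r [hr _ r0 rL]].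
have rf x y y' : r x y -> r x y' -> y = y'.
  move=> rx rx'; apply/eqP; rewrite -subr_eq0; apply/eqP/r0.
  by rewrite -(subrr x); exact: arelB.
have [x0 rx0] := rL l0.
have hD : is_submodule [set x | exists l, r x l].
  split; first split.
  - by exists 0; exact: arel0.
  - by move=> a x y [l rx] [l' ry]; exists (a *: l + l'); exact: arel_lin.
  - by move=> z x [l rx]; exists (act z l); exact: arel_act.
have hK : is_submodule [set x | r x 0].
  split; first split.
  - exact: arel0.
  - move=> a x y rx ry; rewrite -(addr0 0) -{1}(scaler0 _ a); exact: arel_lin.
  - by move=> z x rx; rewrite -(act0 L z); exact: arel_act.
have [D0|DT] := sX _ hD.
  case: l0n0; apply: r0; suff <- : x0 = 0 by [].
  by suff : [set 0] x0 by []; rewrite -D0; exists l0.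
have [K0|KT] := sX _ hK; last first.
  by case: l0n0; apply: rf rx0 _; have : setT x0 by []; rewrite -KT.
have /choice [f rxf] : forall x, exists l, r x l.
  by move=> x; have : setT x by []; rewrite -DT.
have f_lin a x y : f (a *: x + y) = a *: f x + f y.
  by apply: rf (rxf _) _; exact: arel_lin.
have f_act z x : f (act z x) = act z (f x).
  by apply: rf (rxf _) _; exact: arel_act.
exists (lie_hom f_lin f_act).
have /choice [f' rf'] := rL.
exists f' => x /=; last exact: rf (rxf _) (rf' _).
apply/eqP; rewrite -subr_eq0; apply/eqP.
suff : [set 0] (f' (f x) - x) by [].
by rewrite -K0 /= -(subrr (f x)); exact: arelB.
Qed.

Section Cyclic.
Context {M : lieModule g}.

Definition cyclic (v : M) : set M := [set env_act u v | u in [set: envelope g]].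

Lemma cyclicP v w : cyclic v w <-> exists s, w = uterm_act s v.
Proof.
split=> [[u _ <-]|[s ->]]; first by exists (repr u).
by exists (\pi_(envelope g) s) => //; rewrite env_act_pi.
Qed.

Lemma cyclic_self v : cyclic v v.
Proof. by apply/cyclicP; exists (UOne g). Qed.

Lemma cyclic_submodule v : is_submodule (cyclic v).
Proof.
split; first split.
- by apply/cyclicP; exists (UZero g).
- move=> a x y /cyclicP [s ->] /cyclicP [t ->].
  by apply/cyclicP; exists (UAdd (UScale a s) t).
- by move=> z x /cyclicP [s ->]; apply/cyclicP; exists (UMul (UGen z) s).
Qed.

Lemma submodule_uterm (W : set M) s v : is_submodule W -> W v -> W (uterm_act s v).
Proof.
move=> hW; elim: s v => [z|||s IHs t IHt|s IHs t IHt|a s IHs] v Wv //=.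
- exact: hW.2.
- exact: hW.1.1.
- by apply: is_subspaceD; [exact: hW.1|exact: IHs|exact: IHt].
- by apply: IHs; exact: IHt.
- by apply: is_subspaceZ; [exact: hW.1|exact: IHs].
Qed.

Lemma cyclic_min (W : set M) v : is_submodule W -> W v -> cyclic v `<=` W.
Proof. by move=> hW Wv _ /cyclicP [s ->]; exact: submodule_uterm. Qed.

(** A vector related to a nonzero element of [L] already generates enough: what its cyclic module
    reaches in [L] is a nonzero submodule. This turns statements about modules into statements about
    single vectors. *)
Lemma occurs_cyclic (W : set M) L : simple L ->
  occurs W L -> exists2 x, W x & occurs (cyclic x) L.
Proof.
move=> [[l0 l0n0] sL] [r [hr rW r0 rL]]; have [x rx] := rL l0.
exists x; first exact: rW rx.
exists (fun y l => cyclic x y /\ r y l).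
have hC := cyclic_submodule x.
split.
- split; first by split; [exact: hC.1.1|exact: arel0].
    by move=> a y y' l l' [? ?] [? ?]; split; [exact: hC.1.2|exact: arel_lin].
  by move=> z y l [? ?]; split; [exact: hC.2|exact: arel_act].
- by move=> y l [].
- by move=> l [_ /r0].
- have hI : is_submodule [set l | exists y, cyclic x y /\ r y l].
    split; first split.
    + by exists 0; split; [exact: hC.1.1|exact: arel0].
    + move=> a l l' [y [? ?]] [y' [? ?]]; exists (a *: y + y').
      by split; [exact: hC.1.2|exact: arel_lin].
    + by move=> z l [y [? ?]]; exists (act z y); split; [exact: hC.2|exact: arel_act].
  have [I0|IT] := sL _ hI.
    case: l0n0; suff : [set 0] l0 by [].
    by rewrite -I0; exists x; split=> //; exact: cyclic_self.
  by move=> l; have : setT l by []; rewrite -IT.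
Qed.

End Cyclic.

(** Applying the same element of the envelope to [x] and [y] keeps them related, so the relation
    reaches every vector of [cyclic y] from [cyclic x]. *)
Lemma occurs_cyclic_rel M N (r : M -> N -> Prop) x y L :
  arel r -> (forall y, r 0 y -> y = 0) -> r x y ->
  occurs (cyclic y) L -> occurs (cyclic x) L.
Proof.
move=> hr r0 rxy; have hC := cyclic_submodule x.
apply: (occurs_comp (r := fun a b => cyclic x a /\ r a b)).
- split; first by split; [exact: hC.1.1|exact: arel0].
    by move=> a v v' l l' [? ?] [? ?]; split; [exact: hC.1.2|exact: arel_lin].
  by move=> z v l [? ?]; split; [exact: hC.2|exact: arel_act].
- by move=> a b _ [].
- by move=> b _ [_ /r0].
- move=> _ /cyclicP [s ->]; exists (uterm_act s x); split.
    by apply/cyclicP; exists s.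
  exact: arel_uterm.
Qed.

Lemma occurs_cyclic_hom M N (f : lieHom M N) x L :
  occurs (cyclic (f x)) L -> occurs (cyclic x) L.
Proof.
apply: (occurs_cyclic_rel (arel_graph f)) => // y ->; exact: linear0.
Qed.

Lemma occurs_cyclic_inj M N (f : lieHom M N) x L :
  injective f -> occurs (cyclic x) L -> occurs (cyclic (f x)) L.
Proof.
move=> fI; apply: (occurs_cyclic_rel (arel_converse f)) => // y.
by rewrite -(linear0 f) => /fI.
Qed.

End Modules.

(** * Composition series, and nonvanishing of multiplicities *)

Section JordanHoelder.
Context {R : realType} {g : lieAlgebra R}.
Implicit Types M N X L : lieModule g.

Lemma submoduleD M (A B : set M) : is_submodule A -> is_submodule B ->
  is_submodule [set w | exists a b, [/\ A a, B b & w = a + b]].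
Proof.
move=> hA hB; split; first split.
- by exists 0, 0; rewrite addr0; split=> //; [exact: hA.1.1|exact: hB.1.1].
- move=> c _ _ [a [b [Aa Bb ->]]] [a' [b' [Aa' Bb' ->]]].
  exists (c *: a + a'), (c *: b + b'); split; [exact: hA.1.2|exact: hB.1.2|].
  by rewrite scalerDr addrACA.
- move=> z _ [a [b [Aa Bb ->]]]; exists (act z a), (act z b).
  by split; [exact: hA.2|exact: hB.2|exact: actD].
Qed.

Lemma occurs0 M L : simple L -> ~ occurs ([set 0] : set M) L.
Proof.
move=> [[l l0] _] [r [hr r0 rl rL]]; apply: l0; apply: rl.
by have [x rx] := rL l; rewrite -(r0 _ _ rx).
Qed.

Lemma fd_submodule M (W : set M) (h : is_submodule W) k :
  fd k W -> fd k [set: submodule h].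
Proof. exact: fd_ss. Qed.

Lemma fd_subquotient M (A B : set M) (hA : is_submodule A) (hB : is_submodule B) k :
  fd k B -> fd k [set: subquotient hA hB].
Proof.
move=> /(fd_submodule hB) /(fd_image (subq_hom hA hB)).
congr fd; apply/seteqP; split=> // q _.
by have [s <-] := subq_hom_surj q; exists s.
Qed.

Lemma simple_subquotient M (A B : set M) (hA : is_submodule A)
    (hB : is_submodule B) :
  A `<=` B -> A <> B ->
  (forall D, is_submodule D -> A `<=` D -> D `<=` B -> D = A \/ D = B) ->
  simple (subquotient hA hB).
Proof.
move=> AB nAB Dmin; split.
  have [x [Bx nAx]] : exists x, B x /\ ~ A x.
    apply: contrapT => /forallNP H; apply: nAB; apply/seteqP; split=> // x Bx.
    by apply: contrapT => nAx; apply: (H x).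
  have [s sx] := val_hom_surj hB Bx.
  by exists (subq_hom hA hB s) => /subq_hom_eq0; rewrite sx.
move=> W hW.
pose D := [set x | exists s, val_hom hB s = x /\ W (subq_hom hA hB s)].
have hD : is_submodule D.
  split; first split.
  - by exists 0; rewrite !linear0; split=> //; exact: hW.1.1.
  - move=> a _ _ [s [<- Ws]] [t [<- Wt]]; exists (a *: s + t).
    by rewrite !hom_lin; split=> //; exact: hW.1.2.
  - move=> z _ [s [<- Ws]]; exists (act z s); rewrite !lhom_act.
    by split=> //; exact: hW.2.
have [||E|E] := Dmin _ hD.
- move=> x Ax; have [s sx] := val_hom_surj hB (AB _ Ax); exists s; split=> //.
  have -> : subq_hom hA hB s = 0 by apply/subq_hom_eq0; rewrite sx.
  exact: hW.1.1.
- by move=> _ [s [<- _]]; exact: val_homP.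
- left; apply/seteqP; split=> [q|q ->]; last exact: hW.1.1.
  have [s <-] := subq_hom_surj q => Ws; apply/subq_hom_eq0; rewrite -E.
  by exists s.
- right; apply/seteqP; split=> // q _; have [s <-] := subq_hom_surj q.
  have : D (val_hom hB s) by rewrite E; exact: val_homP.
  by move=> [t [/val_hom_inj ->]].
Qed.

(** A minimal submodule strictly above [A] is reached by shrinking [B], since each proper step
    lowers the dimension bound. *)
Lemma exists_simple_subquotient M (A B : set M) k (hA : is_submodule A) :
  is_submodule B -> fd k B -> A `<=` B -> A <> B ->
  exists C (hC : is_submodule C),
    [/\ A `<=` C, C `<=` B, A <> C & simple (subquotient hA hC)].
Proof.
elim/ltn_ind: k B => k IH B hB fB AB nAB.
have [[D [hD AD DB DA DnB]]|noD] := pselect (exists D : set M,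
    [/\ is_submodule D, A `<=` D, D `<=` B, A <> D & D <> B]).
  have [//|[l lk fD]] := fd_sub_proper hD.1 DB fB.
  have [C [hC [AC CD nAC sC]]] := IH _ lk D hD fD AD DA.
  by exists C, hC; split=> //; exact: subset_trans CD DB.
exists B, hB; split=> //; apply: simple_subquotient => // D hD AD DB.
have [->|DA] := pselect (D = A); first by left.
have [->|DnB] := pselect (D = B); first by right.
by case: noD; exists D; split=> // AD'; apply: DA.
Qed.

(** A composition series of the interval from [A] to [B]. The free lower end lets a series be built
    upwards from 0, prepending one simple factor at a time. *)
Definition simple_chain M (A B : set M) k (W : nat -> set M)
    (h : forall i, is_submodule (W i)) : Prop :=
  [/\ W 0%N = A, W k = B & forall i, (i < k)%N ->
    W i `<=` W i.+1 /\ simple (subquotient (h i) (h i.+1))].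

Lemma simple_chain_sub M (A B : set M) k W h i :
  @simple_chain M A B k W h -> (i <= k)%N -> W i `<=` B.
Proof.
move=> [_ <- Ws]; elim: k Ws => [|k IH] Ws; first by rewrite leqn0 => /eqP ->.
rewrite leq_eqVlt => /predU1P [->//|ik].
apply: subset_trans (Ws k (ltnSn k)).1; apply: IH => // j jk.
exact/Ws/ltnW.
Qed.

Lemma simple_chain_exists M (A B : set M) n :
  is_submodule A -> is_submodule B -> fd n B -> A `<=` B ->
  exists k W h, @simple_chain M A B k W h.
Proof.
move=> + hB fB.
(* [m] bounds what is missing between [A] and the bound [n] of [B]. Replacing [A] by a strictly
   larger [C] lowers it by one, because a bound for [C] gives a smaller one for [A]. *)
suff H m : (forall l, fd l A -> (n <= m + l)%N) -> is_submodule A -> A `<=` B ->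
    exists k W h, @simple_chain M A B k W h.
  by apply: (H n) => l _; exact: leq_addr.
elim: m A => [|m IH] A nA hA AB.
  have [->|[l ln fA]] := fd_sub_proper hA.1 AB fB.
    by exists 0%N, (fun=> B), (fun=> hB).
  by have := nA _ fA; rewrite add0n leqNgt ln.
have [->|nAB] := pselect (A = B); first by exists 0%N, (fun=> B), (fun=> hB).
have [C [hC [AC CB nAC sC]]] := exists_simple_subquotient hA hB fB AB nAB.
have [|k [W [h [W0 Wk Ws]]]] := IH C _ hC CB.
  move=> l fC; have [//|[l' l'l fA]] := fd_sub_proper hA.1 AC fC.
  by apply: leq_trans (nA _ fA) _; rewrite addSnnS leq_add2l.
exists k.+1, (fun i => if i is j.+1 then W j else A),
  (fun i => match i return is_submodule (if i is j.+1 then W j else A) with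
            | 0%N => hA | j.+1 => h j end).
split=> // -[_|i]; last exact: Ws.
(* A subquotient depends on the proofs that its ends are submodules, so the two proofs for the
   bottom of the chain must be identified. *)
by subst C; rewrite (Prop_irrelevance (h 0%N) hC).
Qed.

(** The image of [B] in the quotient by [A] and the subquotient are two constructions of one module,
    matched through common representatives in [B]. *)
Lemma occurs_quo_subquotient M (A B : set M) (hA : is_submodule A)
    (hB : is_submodule B) L :
  occurs (quo_hom hA @` B) L -> occurs [set: subquotient hA hB] L.
Proof.
apply: (occurs_comp (r := fun q y => exists s : submodule hB,
  q = subq_hom hA hB s /\ y = quo_hom hA (val_hom hB s))) => //.
- split; first by exists 0; rewrite !linear0.
    by move=> a _ _ _ _ [s [-> ->]] [t [-> ->]]; exists (a *: s + t); rewrite !hom_lin.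
  by move=> z _ _ [s [-> ->]]; exists (act z s); rewrite !lhom_act.
- by move=> y _ [s [/esym/subq_hom_eq0 As ->]]; apply/quo_hom_eq0.
- move=> _ [x Bx <-]; have [s <-] := val_hom_surj hB Bx.
  by exists (subq_hom hA hB s), s.
Qed.

Lemma simple_chain_occurs M (A B : set M) k W h L :
  @simple_chain M A B k W h -> simple L -> occurs B L ->
  occurs A L \/ exists2 i, (i < k)%N & isomorphic (subquotient (h i) (h i.+1)) L.
Proof.
move=> [W0 <- Ws] sL.
elim: k Ws => [|k IH] Ws; first by rewrite W0; left.
move=> /(occurs_quo (h k) sL) [/IH|/(occurs_quo_subquotient (h k.+1)) o].
  case=> [i ik|oA|[i ik iso]]; [exact/Ws/ltnW|by left|right].
  by exists i => //; exact: ltnW.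
right; exists k => //.
by apply: simple_occurs_isomorphic o => //; have [] := Ws k (ltnSn k).
Qed.

(** A nonzero value cannot be the default of [xget], so it counts the factors of an actual series,
    and one of them is [L]. *)
Lemma jh_mult_occurs X L : jh_mult X L <> 0%N -> occurs [set: X] L.
Proof.
rewrite /jh_mult; case: xgetP => [m _ [k [W [h [[_ _ Ws] ->]]]] /eqP|//].
rewrite -lt0n => /card_gt0P [j]; rewrite inE => /asboolP iso.
apply: occurs_sub (occurs_subquotient (occurs_isomorphic iso)).
exact: subsetT.
Qed.

(** [L] appears in every composition series, so the count is positive whichever series [xget] picks;
    existence of a series excludes the default 0. *)
Lemma occurs_jh_mult X L : findim_module X -> simple L ->
  occurs [set: X] L -> jh_mult X L <> 0%N.
Proof.
move=> /findimP [n fX] sL oL; rewrite /jh_mult.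
case: xgetP => [m _ [k [W [h [Wc ->]]]]|noseries].
  have [/(occurs0 sL)//|[i ik iso]] := simple_chain_occurs Wc sL oL.
  apply/eqP; rewrite -lt0n; apply/card_gt0P; exists (Ordinal ik).
  by rewrite inE; apply/asboolP.
have [//|k [W [h Wc]]] :=
  simple_chain_exists (submodule0 X) (submoduleT X) fX _.
by have := noseries _ (ex_intro _ k (ex_intro _ W (ex_intro _ h (conj Wc erefl)))).
Qed.

Lemma locally_finiteP M : locally_finite M <-> forall v : M, exists k, fd k (cyclic v).
Proof. by split=> lfM v; have := lfM v => /findimP. Qed.

Lemma mult_occurs X L : mult X L <> 0%E -> occurs [set: X] L.
Proof.
rewrite /mult; case: xgetP => [m _ [W [h [_ ->]]]|//] sup0.
apply: contrapT => noL; apply: sup0.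
rewrite -[RHS](ereal_sup1 (0 : \bar R)%E); congr ereal_sup.
have jh0 i : jh_mult (submodule (h i)) L = 0%N.
  apply: contrapT => /jh_mult_occurs /occurs_submodule /(occurs_sub (@subsetT _ _)).
  exact: noL.
apply/seteqP; split=> [_ [i _ <-]|_ ->]; first by rewrite jh0.
by exists 0%N => //; rewrite jh0.
Qed.

(** The n-th term is the sum of the cyclic modules of the first n vectors of a spanning sequence. *)
Lemma findim_filtration_exists M : locally_finite M -> countable_dim M ->
  exists W, (forall i, is_submodule (W i)) /\ @findim_filtration _ _ M W.
Proof.
move=> /locally_finiteP lfM [e eM].
pose W := fix W n : set M := if n is n'.+1 then
  [set w | exists a b, [/\ W n' a, cyclic (e n') b & w = a + b]] else [set 0].
have hW i : is_submodule (W i).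
  elim: i => [|i IH]; first exact: submodule0.
  by apply: submoduleD => //; exact: cyclic_submodule.
have WS i : W i `<=` W i.+1.
  move=> x Wx; exists x, 0; rewrite addr0; split=> //.
  exact: (cyclic_submodule _).1.1.
have Wle i j : (i <= j)%N -> W i `<=` W j.
  by move=> /subnK <-; elim: (j - i)%N => // k IH; exact: subset_trans IH (WS _).
exists W; split=> //; split=> //.
  move=> i; apply/findimP; elim: i => [|i [k fW]]; first by exists 0%N.
  by have [l fe] := lfM (e i); exists (l + k)%N; exact: fdD.
apply/seteqP; split=> // x _.
have : lspan (range e) x by rewrite eM.
apply: lspan_min.
- split; first by exists 0%N.
  move=> a y z [i _ Wy] [j _ Wz]; exists (maxn i j) => //.
  by apply: (hW _).1.2; [apply: Wle Wy; exact: leq_maxl|apply: Wle Wz; exact: leq_maxr].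
- move=> _ [i _ <-]; exists i.+1 => //; exists 0, (e i); rewrite add0r.
  by split=> //; [exact: (hW i).1.1|exact: cyclic_self].
Qed.

(** [L] occurs in the cyclic module of one vector, and that vector lies in some term of whichever
    filtration was chosen. *)
Lemma occurs_mult X L : locally_finite X -> countable_dim X -> simple L ->
  occurs [set: X] L -> mult X L <> 0%E.
Proof.
move=> lfX cX sL oL; rewrite /mult; case: xgetP => [m _ [W [h [[_ _ fW WT] ->]]]|nofilt].
  have [x _ ox] := occurs_cyclic sL oL.
  have [i _ Wx] : (\bigcup_i W i) x by rewrite WT.
  have : jh_mult (submodule (h i)) L <> 0%N.
    apply: occurs_jh_mult => //.
      by have /findimP [k fk] := fW i; apply/findimP; exists k; exact: fd_submodule.
    by apply/occurs_submodule; apply: occurs_sub ox; exact: cyclic_min.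
  move=> /eqP; rewrite -lt0n => jh_gt0 sup0.
  have : ((jh_mult (submodule (h i)) L)%:R%:E <= (0 : \bar R))%E.
    by rewrite -sup0; apply: ereal_sup_ubound; exists i.
  by rewrite lee_fin leNgt ltr0n jh_gt0.
have [W [h Wf]] := findim_filtration_exists lfX cX.
by have := nofilt _ (ex_intro _ W (ex_intro _ h (conj Wf erefl))).
Qed.

End JordanHoelder.

(** * Size of tensor products *)

Section TensorProduct.
Context {R : realType}.

Lemma countable_dim_surj (V U : lmodType R[i]) (f : {linear V -> U}) :
  (forall u, exists v, f v = u) -> countable_dim V -> countable_dim U.
Proof.
move=> fS [e eT]; exists (f \o e); apply/seteqP; split=> // u _.
have [v <-] := fS u; have : lspan (range e) v by rewrite eT.
by move=> /(lspan_image f); rewrite image_comp.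
Qed.

Lemma findim_countable_dim (V : lmodType R[i]) : findim [set: V] -> countable_dim V.
Proof.
move=> [k [e eT]]; exists (fun j => if insub j is Some i then e i else 0).
apply/seteqP; split=> // v _; have : setT v by [].
rewrite eT; apply: lspan_min; first exact: lspan_subspace.
by move=> _ [i _ <-]; apply: sub_lspan; exists i => //; rewrite valK.
Qed.

Context {g : lieAlgebra R} {V L : lieModule g}.

Definition vpure_l (l : L) : {linear V -> vtensor V L} :=
  linear_map (fun a v v' => vpure_linl a v v' l).

Definition vpure_r (v : V) : {linear L -> vtensor V L} :=
  linear_map (fun a l l' => vpure_linr a v l l').

Lemma countable_dim_tensor :
  countable_dim V -> countable_dim L -> countable_dim (tensor_module V L).
Proof.
move=> [e eT] [f fT].
exists (fun k => if unpickle k is Some (i, j) then vpure (e i) (f j) else 0).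
apply/seteqP; split=> // z _; set S := lspan _.
have hS : is_subspace S by exact: lspan_subspace.
elim/(@vtensor_ind _ _ V L): z => [v l||z w Sz Sw|a z Sz].
- have : lspan (range e) v by rewrite eT.
  move=> /(lspan_image (vpure_l l)); apply: lspan_min => // _ [_ [i _ <-] <-].
  have : lspan (range f) l by rewrite fT.
  move=> /(lspan_image (vpure_r (e i))); apply: lspan_min => // _ [_ [j _ <-] <-].
  by apply: sub_lspan; exists (pickle (i, j)) => //; rewrite pickleK.
- exact: hS.1.
- exact: is_subspaceD.
- exact: is_subspaceZ.
Qed.

(** [T] need only contain the products: each generator [e] of [B] contributes the image of [A] under
    tensoring with [e]. *)
Lemma fd_tensor k l (A : set V) (B : set L) : fd k A -> fd l B ->
  exists m (T : set (vtensor V L)),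
    fd m T /\ forall a b, A a -> B b -> T (vpure a b).
Proof.
move=> fA; elim: l B => [|l IH] B /=.
  move=> ->; exists 0%N, [set 0]; split=> // a _ _ ->.
  exact: (linear0 (vpure_r a)).
move=> [B' [e [/IH [m [T [fT TAB]]] ->]]].
exists (k + m)%N, [set w | exists t a, [/\ T t, (vpure_l e @` A) a & w = t + a]].
split; first by apply: fdD => //; exact: fd_image.
move=> a b Aa [c B'b]; exists (vpure a (b - c *: e)), (c *: vpure a e).
split; first exact: TAB.
  exists (c *: a); last by rewrite linearZ.
  by apply: is_subspaceZ => //; exact: fd_subspace fA.
by rewrite addrC -vpure_linr addrC subrK.
Qed.

(** A pure tensor with left factor [v] lies in the span of the products of [cyclic v] with [L],
    which is stable and finite dimensional. *)
Lemma locally_finite_tensor :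
  locally_finite V -> findim_module L -> locally_finite (tensor_module V L).
Proof.
move=> /locally_finiteP lfV /findimP [l fL]; apply/locally_finiteP => z.
elim/(@vtensor_ind _ _ V L): z => [v w||z w [k fz] [k' fw]|a z [k fz]].
- have [k fv] := lfV v; have [m [T [fT Tvw]]] := fd_tensor fv fL.
  pose S : set (tensor_module V L) :=
    lspan [set t | exists a b, cyclic v a /\ t = vpure a b].
  have hS : is_submodule S.
    apply: lspan_submodule => x _ [a [b [va ->]]].
    rewrite [act x _]tensor_act_pure.
    apply: is_subspaceD; first exact: lspan_subspace.
      apply: sub_lspan; exists (act x a), b; split=> //.
      exact: (cyclic_submodule v).2.
    by apply: sub_lspan; exists a, (act x b).
  have ST : S `<=` T.
    by apply: lspan_min => [|_ [a [b [va ->]]]]; [exact: fd_subspace fT|exact: Tvw].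
  exists m; apply: (fd_sub _ _ fT); first exact: (cyclic_submodule _).1.
  apply: subset_trans ST; apply: cyclic_min => //.
  by apply: sub_lspan; exists v, w; split=> //; exact: cyclic_self.
- exists 0%N; apply/seteqP; split=> [|x ->].
    by apply: cyclic_min => //; exact: submodule0.
  exact: (cyclic_submodule _).1.1.
- exists (k' + k)%N; apply: (fd_sub _ _ (fdD fz fw)).
    exact: (cyclic_submodule _).1.
  apply: cyclic_min; first by apply: submoduleD; exact: cyclic_submodule.
  by exists z, w; split=> //; exact: cyclic_self.
- exists k; apply: (fd_sub _ _ fz); first exact: (cyclic_submodule _).1.
  have hz := cyclic_submodule (z : tensor_module V L).
  apply: cyclic_min => //; apply: is_subspaceZ; first exact: hz.1.
  exact: cyclic_self.
Qed.

End TensorProduct.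

(** * Decomposition of locally finite n-modules by blocks *)

Section Isotypic.
Context {R : realType} {g : lieAlgebra R} {n : lieSubalgebra g}.
Implicit Types (X : lieModule n) (L S : irrep n) (I J : block n).

Definition block_of L : block n :=
  exist _ (fun Y => linked (iso_class L) Y) (ex_intro _ (iso_class L) erefl).

Lemma in_block_of L : in_block L (block_of L).
Proof. exact: linked_refl. Qed.

Lemma in_block_linked L S I :
  linked (iso_class L) (iso_class S) -> in_block L I -> in_block S I.
Proof.
by case: I => P [Y PE] LS; rewrite /in_block /= PE => YL; exact: linked_trans LS.
Qed.

Lemma in_block_inj L I J : in_block L I -> in_block L J -> I = J.
Proof.
case: I J => [P [Y PE]] [Q [Z QE]]; rewrite /in_block /= => PL QL.
apply: eq_exist => /=; move: PL QL; rewrite {}PE {}QE => YL ZL.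
apply/funext => U; apply/propext; split=> [YU|ZU].
  by apply: linked_trans ZL _; apply: linked_trans (linked_sym YL) YU.
by apply: linked_trans YL _; apply: linked_trans (linked_sym ZL) ZU.
Qed.

Lemma exists_irrep X (W : set X) k : is_submodule W -> fd k W -> W <> [set 0] ->
  exists L, occurs W L.
Proof.
move=> hW fW nW0; have W0 : [set 0] `<=` W by move=> _ ->; exact: hW.1.1.
have [|C [hC [_ CW _ sC]]] :=
  exists_simple_subquotient (submodule0 X) hW fW W0; first exact/nesym.
have fC := fd_sub hC.1 CW fW.
have fS : findim_module (subquotient (submodule0 X) hC).
  by apply/findimP; exists k; exact: fd_subquotient.
exists (Irrep sC fS); apply: occurs_sub CW _.
exact: occurs_subquotient (occurs_refl _).
Qed.

Definition isotypic X I : set X :=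
  [set v | forall L, occurs (cyclic v) L -> in_block L I].

Lemma isotypic_submodule X I : is_submodule (@isotypic X I).
Proof.
split; first split.
- move=> L o; case: (occurs0 (irrep_simple L) (M := X)); apply: occurs_sub o.
  by apply: cyclic_min => //; exact: submodule0.
- move=> a x y Ix Iy L o.
  have [] := @occurs_add _ _ X (cyclic x) (cyclic y) L; try exact: cyclic_submodule.
  + exact: irrep_simple.
  + apply: occurs_sub o; apply: cyclic_min.
      by apply: submoduleD; exact: cyclic_submodule.
    exists (a *: x), y; split=> //; last exact: cyclic_self.
    apply: is_subspaceZ; first exact: (cyclic_submodule x).1.
    exact: cyclic_self.
  + exact: Ix.
  + exact: Iy.
- move=> z x Ix L o; apply: Ix; apply: occurs_sub o; apply: cyclic_min.
    exact: cyclic_submodule.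
  by apply: (cyclic_submodule x).2; exact: cyclic_self.
Qed.

Lemma isotypic_hom X Y (f : lieHom X Y) I v :
  isotypic I v -> isotypic I (f v).
Proof. by move=> Iv L /occurs_cyclic_hom; exact: Iv. Qed.

(** A nonzero vector generates a nonzero finite dimensional module, which has a simple subquotient.
    Directness of the sum and the vanishing of homomorphisms between parts both rest on this. *)
Lemma isotypic_eq0 X I (v : X) : locally_finite X ->
  (forall L, occurs (cyclic v) L -> ~ in_block L I) -> isotypic I v -> v = 0.
Proof.
move=> /locally_finiteP lfX nI Iv; apply: contrapT => v0.
have [k fv] := lfX v.
have [|L oL] := exists_irrep (cyclic_submodule v) fv.
  by move=> C0; apply: v0; suff : [set 0] v by []; rewrite -C0; exact: cyclic_self.
exact: (nI _ oL (Iv _ oL)).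
Qed.

Lemma occurs_cyclic_sum X k (x : 'I_k -> X) L :
  occurs (cyclic (\sum_(i < k) x i)) L -> exists i, occurs (cyclic (x i)) L.
Proof.
elim: k x => [|k IH] x; rewrite ?big_ord0 ?big_ord_recl => o.
  case: (occurs0 (irrep_simple L) (M := X)); apply: occurs_sub o.
  by apply: cyclic_min => //; exact: submodule0.
have [] := @occurs_add _ _ X (cyclic (x ord0))
  (cyclic (\sum_(i < k) x (lift ord0 i))) L; try exact: cyclic_submodule.
- exact: irrep_simple.
- apply: occurs_sub o; apply: cyclic_min.
    by apply: submoduleD; exact: cyclic_submodule.
  by do 2 eexists; split; last reflexivity; exact: cyclic_self.
- by exists ord0.
- by move=> /IH [j oj]; exists (lift ord0 j).
Qed.

(** Split off direct summands until they are indecomposable; all constituents of an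
    indecomposable summand are linked by (I). *)
Lemma isotypic_span_fd X k : fd k [set: X] ->
  lspan [set x | exists I, @isotypic X I x] = setT.
Proof.
elim/ltn_ind: k X => k IH X fX.
have spanX := lspan_subspace [set x | exists I, @isotypic X I x].
apply/seteqP; split=> // v _.
have [->|v0] := pselect (v = 0); first exact: spanX.1.
have [iX|nX] := pselect (indecomposable X).
  have [|L0 oL0] := exists_irrep (submoduleT X) fX.
    by move=> T0; apply: v0; suff : [set 0] v by []; rewrite -T0.
  apply: sub_lspan; exists (block_of L0) => L /(occurs_sub (@subsetT _ _)) oL.
  have fdX : findim_module X by apply/findimP; exists k.
  apply: in_block_linked (in_block_of L0).
  by apply: (linked_indecomposable fdX iX); apply: occurs_jh_mult => //;
    exact: irrep_simple.
have [A [B [hA hB AB0 [ABT nA nB]]]] : exists A B : set X,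
    [/\ is_submodule A, is_submodule B, A `&` B = [set 0] &
      [/\ forall v, exists a b, A a /\ B b /\ v = a + b, A <> [set 0] &
          B <> [set 0]]].
  apply: contrapT => noAB; apply: nX; split; first by exists v.
  move=> A B hA hB AB0 ABT; apply: contrapT => /not_orP [nA nB].
  by apply: noAB; exists A, B.
(* A summand with nonzero complement is proper, hence has a smaller dimension bound; its isotypic
   vectors stay isotypic in [X]. Stated symmetrically to serve both summands. *)
have part C D : is_submodule C -> is_submodule D -> C `&` D = [set 0] ->
    D <> [set 0] -> C `<=` lspan [set x | exists I, @isotypic X I x].
  move=> hC hD CD0 nD.
  have [CT|[l lk fC]] := fd_sub_proper hC.1 (@subsetT _ C) fX.
    by move: CD0; rewrite CT setTI => /nD.
  move=> c Cc; have [s <-] := val_hom_surj hC Cc.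
  have := IH l lk (submodule hC) (fd_submodule hC fC).
  move=> /seteqP [_ /(_ s Logic.I)] /(lspan_image (val_hom hC)).
  apply: lspan_min => // _ [t [I It] <-]; apply: sub_lspan; exists I.
  exact: isotypic_hom.
have [a [b [Aa [Bb ->]]]] := ABT v; apply: is_subspaceD => //.
  exact: part AB0 nB _ Aa.
by move: Bb; apply: (part B A) => //; rewrite setIC.
Qed.

Lemma isotypic_direct_sum X : locally_finite X -> direct_sum (@isotypic X).
Proof.
move=> lfX; split=> [v|k J x injJ Jx sum0 i].
  have /locally_finiteP/(_ v) [k fv] := lfX.
  have hv := cyclic_submodule v.
  have [s sv] := val_hom_surj hv (cyclic_self v).
  have := isotypic_span_fd (fd_submodule hv fv).
  move=> /seteqP [_ /(_ s Logic.I)] /(lspan_image (val_hom hv)); rewrite sv.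
  move=> [m [c [e [eI ->]]]].
  have /choice [J JE] : forall i, exists I, isotypic I (e i).
    by move=> i; have [t [I It] <-] := eI i; exists I; exact: isotypic_hom.
  exists m, J, (fun i => c i *: e i); split=> // i.
  exact: is_subspaceZ (isotypic_submodule X (J i)).1 _ _ (JE i).
apply: (isotypic_eq0 lfX _ (Jx i)) => L oL LJi.
(* Writes [x i] as minus the sum of the others over the same index set. A constituent of [x i] then
   occurs in some [y j], and injectivity of [J] forces [j = i], where [y] is 0. *)
pose y j := if j == i then 0 else - x j.
have xE : x i = \sum_j y j.
  have := sum0; rewrite (bigD1 i) //= => /eqP; rewrite addr_eq0 => /eqP ->.
  rewrite [RHS](bigD1 i) //= {1}/y eqxx add0r -sumrN.
  by apply: eq_bigr => j /negPf ji; rewrite /y ji.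
move: oL; rewrite xE => /occurs_cyclic_sum [j oj].
have Jy : isotypic (J j) (y j).
  rewrite /y; case: eqP => _; first exact: (isotypic_submodule X _).1.1.
  exact: is_subspaceN (isotypic_submodule X (J j)).1 _ (Jx j).
have jE : j = i by apply: injJ; apply: in_block_inj LJi; exact: Jy.
move: oj; rewrite /y jE eqxx => o.
case: (occurs0 (irrep_simple L) (M := X)); apply: occurs_sub o.
by apply: cyclic_min => //; exact: submodule0.
Qed.

End Isotypic.

(** * Stability of the isotypic parts under g *)

Section Stability.
Context {R : realType} {g : lieAlgebra R} {n : lieSubalgebra g} (M : lieModule g).
Let Mn : lieModule n := restriction n M.
Implicit Types (L : irrep n) (I : block n).

Lemma act_restriction (x : n) (v : Mn) : act x v = act (lsub_val x) (v : M).
Proof. by []. Qed.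

Definition gspan (W : set Mn) : set Mn :=
  lspan [set t : Mn | exists (y : g) (w : Mn), W w /\ t = act y (w : M)].

(** For x in n, x (y w) = [x, y] w + y (x w), and x w stays in [W]. *)
Lemma gspan_submodule W : is_submodule W -> is_submodule (gspan W).
Proof.
move=> hW; apply: lspan_submodule => x _ [y [w [Ww ->]]].
rewrite act_restriction.
have -> : act (lsub_val x) (act y (w : M))
    = act (lie (lsub_val x) y) (w : M) + act y (act (lsub_val x) (w : M)).
  by rewrite act_lie subrK.
apply: is_subspaceD; first exact: lspan_subspace.
  by apply: sub_lspan; exists (lie (lsub_val x) y), w.
by apply: sub_lspan; exists y, (act x w); split=> //; exact: hW.2.
Qed.

Section Step.
Context {N A C : set Mn} (hN : is_submodule N) (hA : is_submodule A)
  (hC : is_submodule C) (CN : C `<=` N).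

(** Adding [N] absorbs the ambiguity of y modulo n: for w in [C], a change of y by an element of n
    moves y w inside [N]. *)
Let T (W : set Mn) : set Mn := [set w | exists a b, [/\ N a, gspan W b & w = a + b]].
Let hTA : is_submodule (T A) := submoduleD hN (gspan_submodule hA).
Let Q : lieModule n := subquotient hA hC.
Let V : lieModule n := adjoint_quotient n.

Let q0 (y : g) : V := quo_hom (subalgebra_submodule n) y.
Let q0_act (x : n) y : q0 (lie (lsub_val x) y) = act x (q0 y).
Proof. exact: lhom_act. Qed.
Let q1 : lieHom (submodule hC) Q := subq_hom hA hC.
Let q2 : lieHom Mn (quotient_module hTA) := quo_hom hTA.

(** The product induced by the action on g / n and [C] / [A], computed on chosen representatives. *)
Let mulf (y : V) (s : Q) : quotient_module hTA :=
  q2 (act (sval (cid (quo_hom_surj y)) : g)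
          (val_hom hC (sval (cid (subq_hom_surj s))) : M)).

(** Independence of representatives: y' s' - y s = (y' - y) s' + y (s' - s), where the first term
    lies in n [C], hence in [N], and the second in g [A]. *)
Let mulfE (y : g) (s : submodule hC) :
  mulf (q0 y) (q1 s) = q2 (act y (val_hom hC s : M)).
Proof.
rewrite /mulf.
have y'E := svalP (cid (quo_hom_surj (q0 y))); set y' := sval _ in y'E *.
have s'E := svalP (cid (subq_hom_surj (q1 s))); set s' := sval _ in s'E *.
have ny : lsub_set n (y' - y).
  apply/(quo_hom_eq0 (subalgebra_submodule n)).
  by rewrite linearB; apply/eqP; rewrite subr_eq0; apply/eqP.
have As : A (val_hom hC (s' - s)).
  apply: (@subq_hom_eq0 _ _ _ _ _ hA hC (s' - s)).1.
  by rewrite linearB; apply/eqP; rewrite subr_eq0; apply/eqP.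
apply/eqP; rewrite -subr_eq0 -linearB; apply/eqP/quo_hom_eq0.
have [x xE] : exists x : n, lsub_val x = y' - y.
  by exists (ss_mk (lsub_subspace n) ny).
exists (act x (val_hom hC s')), (act y (val_hom hC (s' - s) : M)); split.
- by apply: hN.2; apply: CN; exact: val_homP.
- by apply: sub_lspan; exists y, (val_hom hC (s' - s)).
- by rewrite act_restriction xE linearB actB act_subl subrKA.
Qed.

Let mulf_balanced : balanced (fun (v : V) (a : R[i]) => a *: v)
  (fun (a : R[i]) (l : Q) => a *: l) mulf.
Proof.
have lin2 a v s s' : mulf v (a *: s + s') = a *: mulf v s + mulf v s'.
  have [y <-] := quo_hom_surj v.
  have [[t <-] [t' <-]] := conj (subq_hom_surj s) (subq_hom_surj s').
  by rewrite -hom_lin !mulfE hom_lin act_linr hom_lin.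
have lin1 a v v' s : mulf (a *: v + v') s = a *: mulf v s + mulf v' s.
  have [[y <-] [y' <-]] := conj (quo_hom_surj v) (quo_hom_surj v').
  have [t <-] := subq_hom_surj s.
  by rewrite -hom_lin !mulfE act_linl hom_lin.
have lin20 v : mulf v 0 = 0.
  by rewrite -[0 in LHS](subrr 0) -scaleN1r addrC lin2 scaleN1r addNr.
have lin10 s : mulf 0 s = 0.
  by rewrite -[0 in LHS](subrr 0) -scaleN1r addrC lin1 scaleN1r addNr.
split=> // v a s.
by rewrite -[a *: v]addr0 lin1 lin10 -[a *: s]addr0 lin2 lin20.
Qed.

Let mult_map : tensor_module V Q -> quotient_module hTA := tensor_lift mulf.

Let mult_map_lin a z w : mult_map (a *: z + w) = a *: mult_map z + mult_map w.
Proof. exact: tensor_lift_linear mulf_balanced _ _ _. Qed.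

Let mult_map_pure v s : mult_map (vpure v s) = mulf v s.
Proof. exact: tensor_lift_pure mulf_balanced _ _. Qed.

(** The Leibniz rule of the tensor action becomes [x, y] w + y (x w) = x (y w). *)
Let mult_map_act x z : mult_map (act x z) = act x (mult_map z).
Proof.
have mult_mapD z' w : mult_map (z' + w) = mult_map z' + mult_map w.
  exact: (linearD (linear_map mult_map_lin)).
elim/(@vtensor_ind _ _ V Q): z => [v s||z w IHz IHw|a z IHz].
- have [y <-] := quo_hom_surj v; have [t <-] := subq_hom_surj s.
  rewrite [act x _]tensor_act_pure mult_mapD !mult_map_pure.
  rewrite -[quo_hom _ y]/(q0 y) -[subq_hom _ _ t]/(q1 t).
  rewrite -q0_act -lhom_act !mulfE -lhom_act -linearD; congr (q2 _).
  by rewrite lhom_act !act_restriction act_lie subrK.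
- rewrite act0 (_ : mult_map 0 = 0) ?act0 //.
  exact: (linear0 (linear_map mult_map_lin)).
- by rewrite actD !mult_mapD actD IHz IHw.
- have mult_mapZ w : mult_map (a *: w) = a *: mult_map w.
    exact: (linearZ_LR (linear_map mult_map_lin)).
  by rewrite actZ !mult_mapZ actZ IHz.
Qed.

(** Modulo [T A], the summand [N] dies and g [C] is covered by the image of [mult_map]. *)
Lemma gspan_step (L : lieModule n) : simple L -> occurs (T C) L ->
  occurs (T A) L \/ occurs [set: tensor_module V Q] L.
Proof.
move=> sL /(occurs_quo hTA sL) [|o]; [by left|right].
pose f := lie_hom mult_map_lin mult_map_act.
apply: (occurs_image (f := f)) => //; apply: occurs_sub o.
have hf : is_subspace (f @` setT).
  split; first by exists 0; rewrite ?linear0.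
  by move=> a _ _ [z _ <-] [w _ <-]; exists (a *: z + w) => //; exact: hom_lin.
move=> _ [_ [a [b [Na Cb ->]]] <-].
have -> : quo_hom hTA (a + b) = quo_hom hTA b.
  rewrite linearD ((quo_hom_eq0 hTA a).2 _) ?add0r //.
  by exists a, 0; rewrite addr0; split=> //; exact: (lspan_subspace _).1.
move: Cb => /(lspan_image (quo_hom hTA)); apply: lspan_min => //.
move=> _ [_ [y [w [Cw ->]]] <-]; have [t <-] := val_hom_surj hC Cw.
exists (vpure (q0 y) (q1 t)) => //.
by rewrite -[LHS]/(mult_map _) mult_map_pure mulfE.
Qed.

End Step.

Context (g_countable : countable_dim g).
Context (gn_locally_finite : locally_finite (adjoint_quotient n)).
Context (M_locally_finite : locally_finite Mn).

(** The constituents of [g N] lie in those of [(g / n) (x) N] and [N]; filtering [N]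
    by simple factors [S] reduces the former to [(g / n) (x) S], where the adjoint
    linkage applies. *)
Lemma isotypic_act I (y : g) (v : Mn) :
  isotypic I v -> isotypic I (act y (v : M) : Mn).
Proof.
move=> Iv L oL; have /locally_finiteP/(_ v) [k fN] := M_locally_finite.
set N := cyclic v in fN; have hN : is_submodule N by exact: cyclic_submodule.
have N0 : [set 0] `<=` N by move=> _ ->; exact: hN.1.1.
have [m [W [h Wc]]] := simple_chain_exists (submodule0 Mn) hN fN N0.
have WN i := @simple_chain_sub _ _ _ _ _ _ _ _ i Wc.
have [W0 Wm Ws] := Wc.
pose T (U : set Mn) : set Mn := [set w | exists a b, [/\ N a, gspan U b & w = a + b]].
have {oL} : occurs (T N) L.
  apply: occurs_sub oL; apply: cyclic_min.
    by apply: submoduleD => //; exact: gspan_submodule.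
  exists 0, (act y (v : M)); rewrite add0r; split=> //; first exact: hN.1.1.
  by apply: sub_lspan; exists y, v; split=> //; exact: cyclic_self.
rewrite -{1}Wm.
have Iconst (S : irrep n) : occurs N S -> in_block S I by exact: Iv.
have sL := irrep_simple L.
(* Descent along the series of [N]. At the bottom only [N] is left, whose constituents lie in [I];
   otherwise [L] either survives in [T (W i)] or occurs in (g / n) (x) S for the factor S between
   [W i] and [W i.+1]. *)
elim: {1 3}m (leqnn m) => [_|i IH im].
  rewrite W0 => oL; apply: Iconst; apply: occurs_sub oL.
  move=> _ [a [b [Na bW ->]]]; apply: is_subspaceD => //; first exact: hN.1.
  apply: (@lspan_min _ _ _ N) bW; first exact: hN.1.
  by move=> _ [z [_ [-> ->]]]; rewrite act0; exact: hN.1.1.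
have [_ sS] := Ws i im.
move=> /(gspan_step hN (h i) (h i.+1) (WN _ im) sL) [|oL]; first exact/IH/ltnW.
have fW : fd k (W i.+1) by apply: fd_sub (WN _ im) fN; exact: (h i.+1).1.
have fS : findim_module (subquotient (h i) (h i.+1)).
  by apply/findimP; exists k; exact: fd_subquotient.
(* Passing from occurrence to a nonzero [mult] requires a filtration of (g / n) (x) S; countability
   of g and local finiteness of g / n provide it. *)
have lnk : linked (iso_class (Irrep sS fS)) (iso_class L).
  apply: linked_adjoint; apply: occurs_mult => //.
    exact: locally_finite_tensor.
  apply: countable_dim_tensor; last exact: findim_countable_dim.
  apply: (countable_dim_surj (f := quo_hom (subalgebra_submodule n))) => //.
  exact: quo_hom_surj.
apply: in_block_linked lnk _; apply: Iconst; apply: occurs_sub (WN _ im) _.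
exact: occurs_subquotient (occurs_refl _).
Qed.

End Stability.

(** * Frobenius reciprocity for induced modules *)

Section Envelope.
Context {R : realType} {g : lieAlgebra R} {n : lieSubalgebra g} (M : lieModule g).

Lemma env_actM (u w : envelope g) (v : M) : env_act (u * w) v = env_act u (env_act w v).
Proof.
have [[s ->] [t ->]] := conj (envelope_surj u) (envelope_surj w).
by rewrite -upiM !env_act_pi.
Qed.

Lemma env_act_linl a (u w : envelope g) (v : M) :
  env_act (a *: u + w) v = a *: env_act u v + env_act w v.
Proof.
have [[s ->] [t ->]] := conj (envelope_surj u) (envelope_surj w).
by rewrite -upiZ -upiD !env_act_pi.
Qed.

Lemma env_act_incl (u : envelope n) (v : M) :
  env_act (env_incl u) v = env_act u (v : restriction n M).
Proof.
have [s ->] := envelope_surj u; rewrite env_incl_pi env_act_pi.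
elim: s v => [x|||s IHs t IHt|s IHs t IHt|a s IHs] v /=.
- exact: env_act_pi.
- exact: env_act_pi.
- exact: env_act_pi.
- by rewrite -[X in X + _]scale1r env_act_linl scale1r IHs IHt.
- by rewrite env_actM IHt IHs.
- have -> : a *: ueval (fun x : n => gen (lsub_val x)) s
      = a *: ueval (fun x : n => gen (lsub_val x)) s + 0 :> envelope g by rewrite addr0.
  by rewrite env_act_linl IHs [env_act 0 v]env_act_pi addr0.
Qed.

Context {N : lieModule n}.

(** The envelope acts on the induced module by left multiplication, so the vectors [ipure 1 x]
    generate it. *)
Lemma uterm_act_ipure s u (x : N) :
  uterm_act s (ipure u x : induced N) = ipure (\pi_(envelope g) s * u) x.
Proof.
pose f := linear_map (fun a u u' => ipure_linl a u u' x).
elim: s u => [z|||s IHs t IHt|s IHs t IHt|a s IHs] u /=.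
- exact: ind_act_pure.
- by rewrite [\pi_(envelope g) _](_ : _ = 0) // mul0r -[RHS]/(f 0) linear0.
- by rewrite [\pi_(envelope g) _](_ : _ = 1) // mul1r.
- by rewrite IHs IHt upiD mulrDl -[RHS]/(f _) linearD.
- by rewrite IHt IHs upiM mulrA.
- by rewrite IHs upiZ -scalerAl -[RHS]/(f _) linearZ.
Qed.

Lemma ipure1_lin a (x y : N) :
  ipure 1 (a *: x + y) = a *: ipure 1 x + ipure 1 y :> ind_space N.
Proof. exact: ipure_linr. Qed.

Lemma ipure1_act (a : n) (x : N) :
  ipure 1 (act a x) = act a (ipure 1 x : restriction n (induced N)).
Proof.
rewrite [RHS]ind_act_pure mulr1 -[gen (lsub_val a)](env_incl_pi (UGen a)).
by rewrite -[env_incl _]mul1r ipure_balance env_act_pi.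
Qed.

Context (h : lieHom N (restriction n M)).

Let ev (u : envelope g) (x : N) : M := env_act u (h x : M).

Let ev_balanced : balanced (fun (u : envelope g) (a : envelope n) => u * env_incl a)
  (fun (a : envelope n) (x : N) => env_act a x) ev.
Proof.
split=> [a u u' x|a u x x'|u a x]; rewrite /ev.
- exact: env_act_linl.
- by rewrite hom_lin; exact: uterm_act_lin.
- by rewrite env_actM env_act_incl /env_act hom_uterm.
Qed.

Let ev_lift : induced N -> M := tensor_lift ev.

Let ev_lift_lin a z w : ev_lift (a *: z + w) = a *: ev_lift z + ev_lift w.
Proof. exact: tensor_lift_linear ev_balanced _ _ _. Qed.

Let ev_lift_act x z : ev_lift (act x z) = act x (ev_lift z).
Proof.
pose f := linear_map ev_lift_lin.
elim/(@ind_space_ind _ _ n N): z => [u v||z w IHz IHw|a z IHz].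
- rewrite [act x _]ind_act_pure [LHS](tensor_lift_pure ev_balanced).
  by rewrite [ev_lift _](tensor_lift_pure ev_balanced) /ev env_actM env_act_pi.
- by rewrite act0 (_ : ev_lift 0 = 0) ?act0 //; exact: (linear0 f).
- have ev_liftD z' w' : ev_lift (z' + w') = ev_lift z' + ev_lift w'.
    exact: (linearD f).
  by rewrite actD !ev_liftD actD IHz IHw.
- have ev_liftZ w : ev_lift (a *: w) = a *: ev_lift w by exact: (linearZ_LR f).
  by rewrite actZ !ev_liftZ actZ IHz.
Qed.

(** The map adjoint to [h], sending u (x) x to u h(x). *)
Definition induced_hom : lieHom (induced N) M := lie_hom ev_lift_lin ev_lift_act.

Lemma induced_hom1 x : induced_hom (ipure 1 x) = h x.
Proof.
rewrite [LHS](tensor_lift_pure ev_balanced) /ev.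
exact: (env_act_pi (UOne g)).
Qed.

End Envelope.

(** * Constituents of a vector inside a g-submodule and in the ambient module *)

Section RestrictHom.
Context {R : realType} {g : lieAlgebra R} (n : lieSubalgebra g).

Definition restrict_hom (M N : lieModule g) (f : lieHom M N) :
    lieHom (restriction n M) (restriction n N) :=
  @lie_hom _ _ (restriction n M) (restriction n N) f (hom_lin f)
    (fun x v => lhom_act f (lsub_val x) v).

Context {M : lieModule g} {W : set M} (hW : is_submodule W).

Lemma occurs_cyclic_submodule (s : submodule hW) (L : lieModule n) :
  occurs (cyclic (s : restriction n (submodule hW))) L <->
  occurs (cyclic (val_hom hW s : restriction n M)) L.
Proof.
split; last exact: (occurs_cyclic_hom (f := restrict_hom (val_hom hW))).
apply: (occurs_cyclic_inj (f := restrict_hom (val_hom hW))).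
by move=> x y; exact: (@val_hom_inj _ _ _ _ hW x y).
Qed.

End RestrictHom.

(** * The trace as an isotypic part, and the theorem *)

Section BlockPart.
Context {R : realType} {g : lieAlgebra R} {n : lieSubalgebra g}.
Context (g_countable : countable_dim g).
Context (gn_locally_finite : locally_finite (adjoint_quotient n)).
Context (M : lieModule g) (M_locally_finite : locally_finite (restriction n M)).

Lemma isotypic_g_submodule (I : block n) :
  is_submodule (@isotypic _ _ _ (restriction n M) I : set M).
Proof.
split; first exact: (isotypic_submodule (restriction n M) I).1.
by move=> y v; exact: isotypic_act.
Qed.

Lemma block_part_isotypic (I : block n) :
  block_part M I = (@isotypic _ _ _ (restriction n M) I : set M).
Proof.
have hI := isotypic_g_submodule I.
apply/seteqP; split.
  apply: lspan_min => [|_ [N [f [fN NI [z _ <-]]]]]; first exact: hI.1.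
  elim/(@ind_space_ind _ _ n N): z => [u x||z w Iz Iw|a z Iz].
  - have [s ->] := envelope_surj u.
    rewrite -[\pi_(envelope g) s]mulr1 -uterm_act_ipure hom_uterm.
    (* Since f(u (x) x) = u f(1 (x) x) and the isotypic part is g-stable, only 1 (x) x remains; it
       is the image of [x] under an n-homomorphism from [N]. *)
    apply: (submodule_uterm s hI) => L.
    pose f1 (x : N) : restriction n M := f (ipure 1 x).
    have f1_lin a y y' : f1 (a *: y + y') = a *: f1 y + f1 y'.
      by rewrite /f1 ipure1_lin; exact: (hom_lin f a (ipure 1 y) (ipure 1 y')).
    have f1_act a y : f1 (act a y) = act a (f1 y).
      by rewrite /f1 ipure1_act; exact: (lhom_act f (lsub_val a) (ipure 1 y)).
    move=> /(@occurs_cyclic_hom _ _ _ _ (lie_hom f1_lin f1_act)).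
    move=> /(occurs_sub (@subsetT _ _)) oL; apply: NI.
    by apply: occurs_jh_mult => //; exact: irrep_simple.
  - by rewrite linear0; exact: hI.1.1.
  - by rewrite linearD; exact: is_subspaceD hI.1 _ _ Iz Iw.
  - by rewrite linearZ; exact: is_subspaceZ hI.1 _ _ Iz.
move=> v Iv; apply: sub_lspan.
have hv := cyclic_submodule (v : restriction n M).
have [s sv] := val_hom_surj hv (cyclic_self _).
(* U(n) v itself serves as [N]: its inclusion into [M] extends to the induced module and sends 1 (x)
   v to v. *)
exists (submodule hv), (induced_hom (val_hom hv)); split.
- have /locally_finiteP/(_ v) [k fv] := M_locally_finite.
  by apply/findimP; exists k; exact: fd_submodule.
- by move=> L /jh_mult_occurs /occurs_submodule; exact: Iv.
- by exists (ipure 1 s) => //; rewrite induced_hom1.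
Qed.

End BlockPart.

Theorem theorem9 (R : realType) (g : lieAlgebra R) (n : lieSubalgebra g)
  (g_countable : countable_dim g)
  (gn_locally_finite : locally_finite (adjoint_quotient n))
  (M : lieModule g) (M_countable : countable_dim M)
  (M_in_category : in_category n M) :
  exists M_sub : forall I : block n, is_submodule (block_part M I),
    [/\ forall (I : block n) (L : irrep n),
          mult (restriction n (submodule (M_sub I))) L <> 0%E -> in_block L I,
        direct_sum (fun I : block n => block_part M I) &
        forall (I J : block n), I <> J ->
          forall f : lieHom (submodule (M_sub I)) (submodule (M_sub J)),
            forall v, f v = 0%R].
Proof.
have partE (I : block n) := block_part_isotypic g_countable gn_locally_finite
  M_in_category I.
have M_sub (I : block n) : is_submodule (block_part M I).
  by rewrite partE; exact: isotypic_g_submodule.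
exists M_sub; split.
- move=> I L /mult_occurs /(occurs_cyclic (irrep_simple L)) [s _].
  move=> /occurs_cyclic_submodule.
  suff : isotypic I (val_hom (M_sub I) s : restriction n M) by exact.
  by rewrite -[X in X _]partE; exact: val_homP.
- have -> : (fun I : block n => block_part M I)
      = (fun I => @isotypic _ _ _ (restriction n M) I) by apply/funext.
  exact: (isotypic_direct_sum M_in_category).
- move=> I J IJ f s; apply: (@val_hom_inj _ _ _ _ (M_sub J)); rewrite linear0.
  (* The image of [s] lies in the part of [J], but its constituents are among those of [s], hence in
     [I]; as the blocks differ, it has none and vanishes. *)
  apply: (isotypic_eq0 (X := restriction n M) (I := J)) => //.
    move=> L /occurs_cyclic_submodule oL LJ; apply: IJ.
    apply: in_block_inj LJ.
    move: oL => /(occurs_cyclic_hom (f := restrict_hom n f)).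
    move=> /occurs_cyclic_submodule.
    suff : isotypic I (val_hom (M_sub I) s : restriction n M) by exact.
    by rewrite -[X in X _]partE; exact: val_homP.
  by rewrite -[X in X _]partE; exact: val_homP.
Qed.
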